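(* Let $n\geq 3$. There do not exist an integer $m\ge 1$ and a zig-zag sequence of morphisms of flows $$\vec{C}_n=X_0\xrightarrow{f_0}X_1\xleftarrow{f_1}X_2\xrightarrow{f_2}\cdots\xleftarrow{f_{2m-1}}X_{2m}=\vec{I}$$ where each $X_i$ is an object of $\mathbf{cell}(\mathbf{Flow})$ and where each morphism $f_i$ is either an S-homotopy equivalence or a T-homotopy equivalence (in the original, non-generalized sense recalled in the context).
   Context: Topological spaces are compactly generated (weak Hausdorff $k$-spaces). A flow $X$ consists of a set $X^0$ (states), spaces $\mathbb{P}_{\alpha,\beta}X$ for $(\alpha,\beta)\in X^0\times X^0$ (nonconstant execution paths from $\alpha$ to $\beta$), and continuous associative composition laws $*:\mathbb{P}_{\alpha,\beta}X\times\mathbb{P}_{\beta,\gamma}X\to\mathbb{P}_{\alpha,\gamma}X$. For $x\in\mathbb{P}_{\alpha,\beta}X$, $s(x)=\alpha$, $t(x)=\beta$; $\mathbb{P}X=\bigsqcup_{\alpha,\beta}\mathbb{P}_{\alpha,\beta}X$. A morphism $f:X\to Y$ of flows is a set map $f^0:X^0\to Y^0$ with a continuous map $\mathbb{P}f:\mathbb{P}X\to\mathbb{P}Y$ compatible with $s,t,*$. The category of flows is $\mathbf{Flow}$. A set is regarded as a flow with empty path space. For a space $Z$, $\mathrm{Glob}(Z)$ is the flow with $0$-skeleton $\{\widehat0,\widehat1\}$, path space $Z$, $s=\widehat 0$, $t=\widehat 1$ (no composable paths). The directed segment is $\vec{I}=\mathrm{Glob}(\{u\})$. $\mathbf{Flow}$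 has a cofibrantly generated model structure whose weak equivalences are the weak S-homotopy equivalences ($f^0$ a bijection and $\mathbb{P}f$ a weak homotopy equivalence), whose fibrations are the $f$ with $\mathbb{P}f$ a Serre fibration, and whose generating cofibrations are $I^{gl}_+=\{\mathrm{Glob}(\mathbf{S}^{n-1})\subset\mathrm{Glob}(\mathbf{D}^n),\,n\ge0\}\cup\{R:\{0,1\}\to\{0\},\ C:\varnothing\to\{0\}\}$. $\mathbf{cell}(\mathbf{Flow})$ is the full subcategory of flows $X$ such that $\varnothing\to X$ is a transfinite composition of pushouts of elements of $I^{gl}_+$. $Q:\mathbf{Flow}\to\mathbf{cell}(\mathbf{Flow})$ is the cofibrant replacement functor. Between objects of $\mathbf{cell}(\mathbf{Flow})$, a morphism is an S-homotopy equivalence if and only if it is a weak S-homotopy equivalence. Tensor product: $(X\otimes Y)^0=X^0\times Y^0$, $\mathbb{P}(X\otimes Y)=(\mathbb{P}X\times\mathbb{P}Y)\sqcup(X^0\times\mathbb{P}Y)\sqcup(\mathbb{P}X\times Y^0)$, with $s,t,*$ defined componentwise, states acting as identities. For $n\geq1$ the full $n$-cube is $\vec{C}_n=Q(\vec{I}^{\otimes n})$. For a flow $Y$ and $A\subset Y^0$, $Y\!\upharpoonright_A$ is the flow with $0$-skeleton $A$ and $\mathbb{P}_{\alpha,\beta}(Y\!\upharpoonright_A)=\mathbb{P}_{\alpha,\beta}Y$ for $\alpha,\beta\in A$. For $\alpha\in Y^0$, $\mathbb{P}^-_\alpha Y$ is the quotient (in compactly generated spaces) of $\bigsqcup_{\beta}\mathbb{P}_{\alpha,\beta}Y$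 by the equivalence relation generated by $x\sim x*y$ for composable $x,y$; $\mathbb{P}^+_\alpha Y$ is the quotient of $\bigsqcup_\beta\mathbb{P}_{\beta,\alpha}Y$ by the relation generated by $y\sim x*y$. T-homotopy equivalence: for $X,Y$ in $\mathbf{cell}(\mathbf{Flow})$, a morphism $f:X\to Y$ is a T-homotopy equivalence if (1) $f$ induces an isomorphism of flows $X\to Y\!\upharpoonright_{f(X^0)}$ (in particular $f^0$ is injective); (2) for every $\alpha\in Y^0\setminus f(X^0)$, $\mathbb{P}^-_\alpha Y$ and $\mathbb{P}^+_\alpha Y$ are singletons; (3) for every $\alpha\in Y^0\setminus f(X^0)$ there are execution paths $u,v$ of $Y$ with $s(u)\in f(X^0)$, $t(u)=\alpha$, $s(v)=\alpha$, $t(v)\in f(X^0)$. *)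

(* Defs.v *)
From HB Require Import structures.
From mathcomp Require Import all_boot all_order all_algebra.
From Stdlib Require Relation_Operators.
From mathcomp Require Import all_classical reals topology normedtype.

Set Implicit Arguments.
Unset Strict Implicit.
Unset Printing Implicit Defensive.

Import Order.TTheory GRing.Theory Num.Theory.
Import numFieldNormedType.Exports.

Local Open Scope classical_set_scope.

Definition compact_hausdorff (K : topologicalType) : Prop :=
  compact [set: K] /\ hausdorff_space K.

Definition k_open (X : topologicalType) (A : set X) : Prop :=
  forall (K : topologicalType) (u : K -> X),
    compact_hausdorff K -> continuous u -> open (u @^-1` A).

Definition k_space (X : topologicalType) : Prop :=
  forall A : set X, k_open A -> open A.

Definition weak_hausdorff (X : topologicalType) : Prop :=
  forall (K : topologicalType) (u : K -> X),
    compact_hausdorff K -> continuous u -> closed (range u).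

Record cgspace := CGSpace {
  cg_carrier :> topologicalType;
  cg_weak_hausdorff : weak_hausdorff cg_carrier;
  cg_k_space : k_space cg_carrier }.

Definition in_set (T : Type) (A : set T) (x : T) (Ax : A x) : set_type A :=
  exist _ x (mem_set Ax).

Lemma set_type_compact (T : topologicalType) (A : set T) :
  compact A -> compact [set: set_type A].
Proof.
move=> cA F FF _.
have [|x [Ax clx]] := cA (set_val @ F) _.
  by rewrite nbhs_simpl /=; apply: (filterS _ filterT) => x _; exact: set_valP.
exists (in_set Ax); split=> // B V FB [_ /= [[W oW <-] Wx WV]].
have [||y [[z Bz <-] Wy]] := clx (set_val @` B) W.
- rewrite nbhs_simpl /=; apply: filterS FB => z Bz; by exists z.
- by apply: open_nbhs_nbhs; split.
- by exists z; split=> //; exact: WV.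
Qed.

Lemma set_type_hausdorff (T : topologicalType) (A : set T) :
  hausdorff_space T -> hausdorff_space (set_type A).
Proof.
move=> hT x y xy; apply: val_inj; apply: hT => B C nB nC.
have [||z [Bz Cz]] := xy (set_val @^-1` B) (set_val @^-1` C).
- exact: initial_continuous.
- exact: initial_continuous.
- by exists (set_val z); split.
Qed.

Lemma set_val_continuous (T : topologicalType) (A : set T) :
  continuous (set_val : set_type A -> T).
Proof. exact: initial_continuous. Qed.

Lemma closed_compact_hausdorff (K : topologicalType) (A : set K) :
  compact_hausdorff K -> closed A -> compact_hausdorff (set_type A).
Proof.
move=> [cK hK] clA; split; last exact: set_type_hausdorff.
exact/set_type_compact/(subclosed_compact clA cK)/subsetT.
Qed.

Lemma image_closed (X K : topologicalType) (u : K -> X) (A : set K) :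
  weak_hausdorff X -> compact_hausdorff K -> continuous u -> closed A ->
  closed (u @` A).
Proof.
move=> wX hK cu clA.
have -> : u @` A = range (u \o (set_val : set_type A -> K)).
  rewrite predeqE => x; split=> [[k Ak <-]|[k _ <-]].
    by exists (in_set Ak).
  by exists (set_val k) => //; exact: set_valP.
apply: wX; first exact: closed_compact_hausdorff.
by move=> k; apply: continuous_comp; [exact: set_val_continuous|exact: cu].
Qed.

Lemma set1_compact_hausdorff (T : topologicalType) (x : T) :
  compact_hausdorff (set_type [set x]).
Proof.
split; first exact/set_type_compact/compact_set1.
move=> [y hy] [z hz] _; apply: val_inj => /=.
by move/set_mem: hy => ->; move/set_mem: hz => ->.
Qed.

Lemma weak_hausdorff_closed1 (X : topologicalType) (x : X) :
  weak_hausdorff X -> closed [set x].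
Proof.
move=> wX.
have -> : [set x] = range (set_val : set_type [set x] -> X).
  rewrite predeqE => y; split=> [->|[z _ <-]]; last exact: set_valP.
  by exists (in_set (A := [set x]) (erefl x)).
by apply: wX; [exact: set1_compact_hausdorff|exact: set_val_continuous].
Qed.

Lemma image_separated (X K : topologicalType) (u : K -> X) (p q : K) :
  weak_hausdorff X -> compact_hausdorff K -> continuous u -> u p <> u q ->
  exists U V : set K, [/\ open U, open V, U p, V q &
    forall a b, U a -> V b -> u a <> u b].
Proof.
move=> wX hK cu pq; have [cK sK] := hK.
pose A := u @^-1` [set u p]; pose B := u @^-1` [set u q].
have clA : closed A.
  apply: closed_comp (weak_hausdorff_closed1 (x := u p) wX) => ? _.
  exact: cu.
have clB : closed B.
  apply: closed_comp (weak_hausdorff_closed1 (x := u q) wX) => ? _.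
  exact: cu.
have nB : set_nbhs A (~` B).
  move=> x Ax; apply: open_nbhs_nbhs; split; first exact: closed_openC.
  by rewrite /B /= => xq; apply: pq; rewrite -xq.
have [W AW WB] := compact_normal sK cK clA nB.
pose U0 := W°; pose V0 := ~` closure W.
have AU0 : A `<=` U0 by move=> x /AW.
have BV0 : B `<=` V0 by move=> x Bx /WB; exact.
have oU0 : open U0 by exact: open_interior.
have oV0 : open V0 by apply: closed_openC; exact: closed_closure.
pose C1 := u @` (~` U0); pose C2 := u @` (~` V0).
have cl1 : closed C1 by apply: image_closed => //; exact: open_closedC.
have cl2 : closed C2 by apply: image_closed => //; exact: open_closedC.
exists (u @^-1` ~` C1), (u @^-1` ~` C2); split.
- by apply: open_comp (closed_openC cl1) => ? _; exact: cu.
- by apply: open_comp (closed_openC cl2) => ? _; exact: cu.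
- by move=> [x Ux xp]; apply: Ux; apply: AU0.
- by move=> [x Ux xp]; apply: Ux; apply: BV0.
move=> a b Ua Vb ab.
have Wa : U0 a by apply: contrapT => na; apply: Ua; exists a.
have : V0 a by apply: contrapT => na; apply: Vb; exists a.
by apply; apply: subset_closure; exact: interior_subset.
Qed.

Lemma compact_hausdorff_cg (K : topologicalType) :
  compact_hausdorff K -> weak_hausdorff K /\ k_space K.
Proof.
move=> [cK hK]; split=> [L u [cL _] cu|A kA].
  apply: compact_closed => //; apply: continuous_compact => //.
  exact: continuous_subspaceT.
by apply: (kA K id) => // x; exact.
Qed.

Definition cg_compact (T : topologicalType) (A : set T)
    (hT : hausdorff_space T) (cA : compact A) : cgspace :=
  let cg := compact_hausdorff_cg
    (conj (set_type_compact cA) (set_type_hausdorff hT)) in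
  CGSpace cg.1 cg.2.

Lemma discrete_cg (S : choiceType) :
  weak_hausdorff (discrete_topology S) /\ k_space (discrete_topology S).
Proof.
by split=> [K u _ _|A _]; [exact: discrete_closed|exact: discrete_open].
Qed.

Definition cg_discrete (S : choiceType) : cgspace :=
  CGSpace (discrete_cg S).1 (discrete_cg S).2.

Lemma continuous_open_subtype (K Z : topologicalType) (N : set K) (f : K -> Z)
    (k : K) : open N -> N k ->
  continuous (f \o (set_val : set_type N -> K)) -> {for k, continuous f}.
Proof.
move=> oN Nk cf B nB.
have [_ /= [[W oW <-] Wk WB]] := cf (in_set Nk) B nB.
have : nbhs k (W `&` N) by apply: open_nbhs_nbhs; split=> //; exact: openI.
by apply: filterS => x [Wx Nx]; exact: (WB (in_set Nx) Wx).
Qed.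

Section Coproduct.
Variables (I : choiceType) (X : I -> topologicalType).

Definition fiber (K : Type) (u : K -> {i & X i}) (i : I) : set K :=
  [set k | projT1 (u k) = i].

Definition fiber_map (K : choiceType) (u : K -> {i & X i}) (i : I)
    (k : set_type (fiber u i)) : X i :=
  ecast j (X j) (set_valP k) (projT2 (u (set_val k))).

Lemma fiber_mapE (K : choiceType) (u : K -> {i & X i}) (i : I)
    (k : set_type (fiber u i)) :
  existT X i (fiber_map k) = u (set_val k).
Proof.
rewrite /fiber_map; move: (set_valP k) => /=; rewrite /fiber /=.
by move: (u (set_val k)) => {k} [j x] /= e; case: i / e.
Qed.

Lemma fiber_clopen (K : topologicalType) (u : K -> {i & X i}) (i : I) :
  continuous u -> clopen (fiber u i).
Proof.
move=> cu; have fE j : fiber u j = u @^-1` (existT X j @` setT).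
  rewrite predeqE => k; rewrite /fiber /=; split=> [|[x _] <-//].
  by case: (u k) => a x /= <-; exists x.
have o j : open (fiber u j).
  rewrite fE; apply: open_comp; first by move=> ? _; exact: cu.
  exact/existT_open_map/openT.
split; first exact: o.
rewrite -[X in closed X]setCK; apply: open_closedC.
have -> : ~` fiber u i = \bigcup_(j in [set j | j <> i]) fiber u j.
  rewrite predeqE => k; split=> [ki|[j ji kj] ki].
    by exists (projT1 (u k)).
  by apply: ji; rewrite -kj -ki.
by apply: bigcup_open => j _.
Qed.

Lemma fiber_map_continuous (K : topologicalType) (u : K -> {i & X i}) (i : I) :
  continuous u -> continuous (@fiber_map K u i).
Proof.
move=> cu; apply/continuousP => A oA.
have -> : @fiber_map K u i @^-1` A =
    (u \o (set_val : set_type (fiber u i) -> K)) @^-1` (existT X i @` A).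
  rewrite predeqE => k /=; split=> [Ak|[x Ax]].
    by exists (fiber_map k) => //; exact: fiber_mapE.
  by rewrite -fiber_mapE => e; rewrite -(existT_inj2 e).
apply: open_comp; last exact: existT_open_map.
move=> k _; by apply: continuous_comp; [exact: set_val_continuous|exact: cu].
Qed.

Lemma sigT_weak_hausdorff :
  (forall i, weak_hausdorff (X i)) -> weak_hausdorff {i & X i}.
Proof.
move=> wX K u hK cu; rewrite -[X in closed X]setCK; apply: open_closedC.
apply/sigT_openP => i.
suff : closed (existT X i @^-1` range u) by exact: closed_openC.
have -> : existT X i @^-1` range u = range (@fiber_map K u i).
  rewrite predeqE => x /=; split=> [[k _ e]|[k _ <-]].
    have fk : fiber u i k by rewrite /fiber /= e.
    by exists (in_set fk) => //; apply: (@existT_inj2 _ X); rewrite fiber_mapE.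
  by exists (set_val k) => //; rewrite fiber_mapE.
apply: wX; last exact: fiber_map_continuous.
by apply: closed_compact_hausdorff => //; exact: (fiber_clopen i cu).2.
Qed.

Lemma sigT_k_space : (forall i, k_space (X i)) -> k_space {i & X i}.
Proof.
move=> kX A kA; apply/sigT_openP => i; apply: kX => K u hK cu.
apply: (kA K (existT X i \o u)) => // k.
by apply: continuous_comp; [exact: cu|exact: existT_continuous].
Qed.
End Coproduct.

Definition cg_sum (I : choiceType) (X : I -> cgspace) : cgspace :=
  @CGSpace {i & X i}
    (sigT_weak_hausdorff (fun i => @cg_weak_hausdorff (X i)))
    (sigT_k_space (fun i => @cg_k_space (X i))).

(* [X] with its k-open sets as open sets; the product of compactly generated
   spaces carries this refinement of the product topology. *)
Definition kify (X : Type) : Type := X.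

Section Kify.
Variable X : topologicalType.

Lemma k_openT : k_open [set: X].
Proof. by move=> K u _ _; rewrite preimage_setT; exact: openT. Qed.

Lemma k_openI : setI_closed (@k_open X).
Proof.
move=> A B kA kB K u hK cu; rewrite preimage_setI.
by apply: openI; [exact: kA|exact: kB].
Qed.

Lemma k_open_bigU (I : Type) (A : I -> set X) :
  (forall i, k_open (A i)) -> k_open (\bigcup_i A i).
Proof.
move=> kA K u hK cu; rewrite preimage_bigcup; apply: bigcup_open => i _.
exact: kA.
Qed.

HB.instance Definition _ := Choice.on (kify X).
HB.instance Definition _ :=
  isOpenTopological.Build (kify X) k_openT k_openI k_open_bigU.

Lemma kify_openE (A : set X) : @open (kify X) A = k_open A.
Proof. by []. Qed.

Lemma open_kify (A : set X) : open A -> @open (kify X) A.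
Proof.
move=> oA; rewrite kify_openE => K u _ cu.
by apply: open_comp oA => k _; exact: cu.
Qed.

Lemma from_kify_continuous : continuous (id : kify X -> X).
Proof. by apply/continuousP => A oA; exact: open_kify. Qed.

Lemma to_kify_continuous (K : topologicalType) (u : K -> X) :
  compact_hausdorff K -> continuous u -> continuous (u : K -> kify X).
Proof.
by move=> hK cu; apply/continuousP => A /=; rewrite kify_openE; exact.
Qed.

Lemma of_kify_continuous (K : topologicalType) (u : K -> kify X) :
  continuous u -> continuous (u : K -> X).
Proof.
move=> cu; apply/continuousP => A oA; move/continuousP: cu; apply.
exact: open_kify.
Qed.

Lemma kify_k_space : k_space (kify X).
Proof.
move=> A kA; rewrite kify_openE => K u hK cu.
by apply: (kA K u) => //; exact: to_kify_continuous.
Qed.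

Lemma continuous_kify (Z : topologicalType) (h : X -> Z) :
  (forall (K : topologicalType) (u : K -> X), compact_hausdorff K ->
     continuous u -> continuous (h \o u)) ->
  continuous (h : kify X -> Z).
Proof.
move=> ch; apply/continuousP => A oA; rewrite kify_openE => K u hK cu.
by have /continuousP := ch K u hK cu; exact.
Qed.
End Kify.

Lemma images_separated (X K L : topologicalType) (f : K -> X) (g : L -> X)
    (k : K) (l : L) :
  weak_hausdorff X -> compact_hausdorff K -> compact_hausdorff L ->
  continuous f -> continuous g -> f k <> g l ->
  exists U V, [/\ open U, open V, U k, V l &
    forall a b, U a -> V b -> f a <> g b].
Proof.
move=> wX [cK hK] [cL hL] cf cg fg.
pose M (b : bool) : topologicalType := if b then K else L.
pose w (b : bool) : M b -> X :=
  match b return (if b then K else L) -> X with true => f | false => g end.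
have hM : compact_hausdorff {b & M b}.
  split; last by apply: sigT_hausdorff => -[].
  by apply: sigT_compact; [exact: finite_finset|case].
pose W (m : {b & M b}) := w (projT1 m) (projT2 m).
have cw : continuous W by apply: (@sigT_continuous _ M X w) => -[].
have [|U [V [oU oV Uk Vl UV]]] :=
  @image_separated X _ W (existT M true k) (existT M false l) wX hM cw.
  by [].
exists (existT M true @^-1` U), (existT M false @^-1` V); split => //.
- by move/sigT_openP: oU => /(_ true).
- by move/sigT_openP: oV => /(_ false).
- by move=> a b Ua Vb; exact: UV Ua Vb.
Qed.

Lemma coincidence_closed (X K L : topologicalType) (f : K -> X) (g : L -> X) :
  weak_hausdorff X -> compact_hausdorff K -> compact_hausdorff L ->
  continuous f -> continuous g -> closed [set p : K * L | f p.1 = g p.2].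
Proof.
move=> wX hK hL cf cg; rewrite -[X in closed X]setCK; apply: open_closedC.
rewrite openE => -[k l] /= fg; rewrite /interior.
have [U [V [oU oV Uk Vl UV]]] := images_separated wX hK hL cf cg fg.
exists (U, V) => /=; first by split; exact: open_nbhs_nbhs.
by move=> [a b] /= [Ua Vb]; exact: UV.
Qed.

Lemma prod_k_closed (X Y : topologicalType) (K L : topologicalType)
    (u : K -> X * Y) (v : L -> X * Y) :
  weak_hausdorff X -> weak_hausdorff Y ->
  compact_hausdorff K -> compact_hausdorff L -> continuous u -> continuous v ->
  closed (v @^-1` range u).
Proof.
move=> wX wY hK hL cu cv.
have c1 (T : topologicalType) (f : T -> X * Y) :
    continuous f -> continuous (fst \o f).
  by move=> cf t; apply: continuous_comp; [exact: cf|exact: cvg_fst].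
have c2 (T : topologicalType) (f : T -> X * Y) :
    continuous f -> continuous (snd \o f).
  by move=> cf t; apply: continuous_comp; [exact: cf|exact: cvg_snd].
pose E := [set p : K * L | (fst \o u) p.1 = (fst \o v) p.2] `&`
          [set p : K * L | (snd \o u) p.1 = (snd \o v) p.2].
have clE : closed E.
  apply: closedI.
    by apply: (coincidence_closed wX) => //; exact: c1.
  by apply: (coincidence_closed wY) => //; exact: c2.
have -> : v @^-1` range u = snd @` E.
  rewrite predeqE => l /=; split=> [[k _ uv]|[[k l'] [/= e1 e2] <-]].
    by exists (k, l) => //; split; rewrite /= uv.
  by exists k => //; rewrite [u k]surjective_pairing e1 e2 -surjective_pairing.
apply: compact_closed; first exact: hL.2.
apply: continuous_compact.
  by apply: continuous_subspaceT => p; exact: cvg_snd.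
have cKL : compact [set: K * L].
  by rewrite -setXTT; apply: compact_setX; [exact: hK.1|exact: hL.1].
exact: (subclosed_compact clE cKL).
Qed.

Lemma kprod_weak_hausdorff (X Y : topologicalType) :
  weak_hausdorff X -> weak_hausdorff Y ->
  weak_hausdorff (kify (X * Y)%type).
Proof.
move=> wX wY K u hK cu; rewrite -[X in closed X]setCK; apply: open_closedC.
rewrite kify_openE => L v hL cv; rewrite preimage_setC; apply: closed_openC.
by apply: prod_k_closed => //; exact: of_kify_continuous.
Qed.

Definition cg_prod (X Y : cgspace) : cgspace :=
  @CGSpace (kify (X * Y)%type)
    (kprod_weak_hausdorff (@cg_weak_hausdorff X) (@cg_weak_hausdorff Y))
    (@kify_k_space (X * Y)%type).


Section ProductFacts.
Variables X Y : cgspace.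

Lemma cg_fst_continuous : continuous (fun p : cg_prod X Y => p.1).
Proof.
apply: (@continuous_kify (X * Y)%type X fst) => K u _ cu k.
by apply: continuous_comp; [exact: cu|exact: cvg_fst].
Qed.

Lemma cg_snd_continuous : continuous (fun p : cg_prod X Y => p.2).
Proof.
apply: (@continuous_kify (X * Y)%type Y snd) => K u _ cu k.
by apply: continuous_comp; [exact: cu|exact: cvg_snd].
Qed.

Lemma cg_pair_continuous (K : topologicalType) (u : K -> X) (v : K -> Y) :
  compact_hausdorff K -> continuous u -> continuous v ->
  continuous (fun k => (u k, v k) : cg_prod X Y).
Proof.
move=> hK cu cv.
apply: (@to_kify_continuous (X * Y)%type K (fun k => (u k, v k))) => // k.
exact: cvg_pair (cu k) (cv k).
Qed.

Lemma cg_prod_continuous (Z : topologicalType) (h : cg_prod X Y -> Z) :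
  (forall (K : topologicalType) (u : K -> X) (v : K -> Y),
     compact_hausdorff K -> continuous u -> continuous v ->
     continuous (fun k => h (u k, v k))) ->
  continuous h.
Proof.
move=> ch; apply: (@continuous_kify (X * Y)%type Z h) => K u hK cu.
have -> : h \o u = fun k => h ((u k).1, (u k).2).
  by apply/funext => k /=; rewrite -surjective_pairing.
by apply: ch => // k; apply: continuous_comp;
  [exact: cu|exact: cvg_fst|exact: cu|exact: cvg_snd].
Qed.
End ProductFacts.

Lemma cg_prod_sum_continuous (I J : choiceType) (X : I -> cgspace)
    (Y : J -> cgspace) (Z : topologicalType)
    (h : cg_prod (cg_sum X) (cg_sum Y) -> Z) :
  (forall i j, continuous
     (fun p : cg_prod (X i) (Y j) => h (existT _ i p.1, existT _ j p.2))) ->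
  continuous h.
Proof.
move=> ch; apply: cg_prod_continuous => K u v hK cu cv k0.
pose i := projT1 (u k0); pose j := projT1 (v k0).
pose F := fiber u i; have [oF cF] := fiber_clopen i cu.
pose G := fiber v j; have [oG cG] := fiber_clopen j cv.
apply: (@continuous_open_subtype K Z (F `&` G)) => //; first exact: openI.
pose N := set_type (F `&` G).
have hN : compact_hausdorff N.
  by apply: closed_compact_hausdorff => //; exact: closedI.
have fu (n : N) : fiber u i (set_val n) by have [] := set_valP n.
have fv (n : N) : fiber v j (set_val n) by have [] := set_valP n.
pose a (n : N) : X i := fiber_map (in_set (fu n)).
pose b (n : N) : Y j := fiber_map (in_set (fv n)).
have ca : continuous a.
  move=> n; apply: (@continuous_comp _ _ _ (fun n => in_set (fu n)));
    last exact: fiber_map_continuous.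
  apply: (@continuous_comp_initial _ _ _ set_val) => m.
  exact: set_val_continuous.
have cb : continuous b.
  move=> n; apply: (@continuous_comp _ _ _ (fun n => in_set (fv n)));
    last exact: fiber_map_continuous.
  apply: (@continuous_comp_initial _ _ _ set_val) => m.
  exact: set_val_continuous.
have -> : (fun k => h (u k, v k)) \o (set_val : N -> K) =
          (fun n => h (existT _ i (a n), existT _ j (b n))).
  by apply/funext => n /=; rewrite !fiber_mapE.
move=> n; apply: (@continuous_comp _ _ _
  (fun n => (a n, b n) : cg_prod (X i) (Y j))
  (fun p : cg_prod (X i) (Y j) => h (existT _ i p.1, existT _ j p.2))).
  exact: cg_pair_continuous.
exact: ch.
Qed.

Record flow := Flow {
  state : choiceType;
  epath : state -> state -> cgspace;
  ecomp : forall a b c, epath a b -> epath b c -> epath a c;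
  ecomp_continuous : forall a b c,
    continuous (fun p : cg_prod (epath a b) (epath b c) => ecomp p.1 p.2);
  ecompA : forall a b c d (x : epath a b) (y : epath b c) (z : epath c d),
    ecomp (ecomp x y) z = ecomp x (ecomp y z) }.

Arguments epath : clear implicits.
Arguments ecomp {f a b c}.

Record hom (X Y : flow) := Hom {
  hom0 : state X -> state Y;
  homP : forall a b, epath X a b -> epath Y (hom0 a) (hom0 b);
  homP_continuous : forall a b, continuous (@homP a b);
  homP_comp : forall a b c (x : epath X a b) (y : epath X b c),
    homP (ecomp x y) = ecomp (homP x) (homP y) }.

Arguments homP {X Y} h {a b}.

Definition id_hom (X : flow) : hom X X :=
  @Hom X X id (fun _ _ x => x) (fun _ _ _ => cvg_id) (fun _ _ _ _ _ => erefl).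

Lemma comp_hom_continuous (X Y Z : flow) (g : hom Y Z) (f : hom X Y) a b :
  continuous (fun x : epath X a b => homP g (homP f x)).
Proof.
by move=> x; apply: continuous_comp; exact: homP_continuous.
Qed.

Lemma comp_hom_comp (X Y Z : flow) (g : hom Y Z) (f : hom X Y) a b c
    (x : epath X a b) (y : epath X b c) :
  homP g (homP f (ecomp x y)) = ecomp (homP g (homP f x)) (homP g (homP f y)).
Proof. by rewrite !homP_comp. Qed.

Definition comp_hom (X Y Z : flow) (g : hom Y Z) (f : hom X Y) : hom X Z :=
  @Hom X Z (fun a => hom0 g (hom0 f a)) (fun a b x => homP g (homP f x))
    (@comp_hom_continuous X Y Z g f) (@comp_hom_comp X Y Z g f).

Notation "g \oh f" := (comp_hom g f) (at level 50, left associativity).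

Definition is_iso (X Y : flow) (f : hom X Y) : Prop :=
  exists g : hom Y X, g \oh f = id_hom X /\ f \oh g = id_hom Y.

Definition path_space (X : flow) : cgspace :=
  cg_sum (fun ab : state X * state X => epath X ab.1 ab.2).

Definition hom_path (X Y : flow) (f : hom X Y) (p : path_space X) :
    path_space Y :=
  existT _ (hom0 f (projT1 p).1, hom0 f (projT1 p).2) (homP f (projT2 p)).

Definition cg_empty : cgspace := cg_discrete void.
Definition cg_point : cgspace := cg_discrete unit.

Section SetFlow.
Variable S : choiceType.

Definition set_path (a b : S) : cgspace := cg_empty.

Definition set_comp (a b c : S) (x : set_path a b) (y : set_path b c) :
  set_path a c := x.

Lemma set_comp_continuous (a b c : S) :
  continuous (fun p : cg_prod (set_path a b) (set_path b c) =>
    set_comp p.1 p.2).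
Proof. by case=> -[]. Qed.

Lemma set_compA (a b c d : S) (x : set_path a b) (y : set_path b c)
    (z : set_path c d) :
  set_comp (set_comp x y) z = set_comp x (set_comp y z).
Proof. by []. Qed.

Definition set_flow : flow := Flow set_comp_continuous set_compA.

Lemma set_hom_continuous (X : flow) (f : S -> state X) (a b : S) :
  continuous (fun x : set_path a b =>
    match x return epath X (f a) (f b) with end).
Proof. by case. Qed.

Lemma set_hom_comp (X : flow) (f : S -> state X) (a b c : S)
    (x : set_path a b) (y : set_path b c) :
  match set_comp x y return epath X (f a) (f c) with end =
  ecomp (match x return epath X (f a) (f b) with end)
        (match y return epath X (f b) (f c) with end).
Proof. by case: x. Qed.

Definition set_hom (X : flow) (f : S -> state X) : hom set_flow X :=
  @Hom set_flow X f (fun a b x => match x with end)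
    (@set_hom_continuous X f) (@set_hom_comp X f).
End SetFlow.

Definition initial_hom (X : flow) : hom (set_flow void) X :=
  set_hom (fun a : void => match a return state X with end).

Section Globe.
Variable Z : cgspace.

(* The states are [false] for the initial state and [true] for the final one. *)
Definition glob_path (a b : bool) : cgspace :=
  match a, b with false, true => Z | _, _ => cg_empty end.

Definition glob_comp (a b c : bool) :
    glob_path a b -> glob_path b c -> glob_path a c :=
  match a, b return glob_path a b -> glob_path b c -> glob_path a c with
  | false, true => fun _ y => match y : void with end
  | _, _ => fun x _ => match x : void with end
  end.

Lemma glob_comp_continuous (a b c : bool) :
  continuous (fun p : cg_prod (glob_path a b) (glob_path b c) =>
    glob_comp p.1 p.2).
Proof. by case: a b => -[] [x y]; [case: x|case: x|case: y|case: x]. Qed.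

Lemma glob_compA (a b c d : bool) (x : glob_path a b) (y : glob_path b c)
    (z : glob_path c d) :
  glob_comp (glob_comp x y) z = glob_comp x (glob_comp y z).
Proof. by case: a b x y => -[] x y; [case: x|case: x|case: y|case: x]. Qed.

Definition glob : flow := Flow glob_comp_continuous glob_compA.
End Globe.

Section GlobeMap.
Variables (Z W : cgspace) (f : Z -> W).
Hypothesis cf : continuous f.

Definition glob_map_path (a b : bool) : glob_path Z a b -> glob_path W a b :=
  match a, b return glob_path Z a b -> glob_path W a b with
  | false, true => f
  | _, _ => id
  end.

Lemma glob_map_continuous (a b : bool) : continuous (@glob_map_path a b).
Proof. by case: a b => -[] //; exact: cf. Qed.

Lemma glob_map_comp (a b c : bool) (x : glob_path Z a b) (y : glob_path Z b c) :
  glob_map_path (glob_comp x y) =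
  glob_comp (glob_map_path x) (glob_map_path y).
Proof. by case: a b x y => -[] x y; [case: x|case: x|case: y|case: x]. Qed.

Definition glob_map : hom (glob Z) (glob W) :=
  @Hom (glob Z) (glob W) id glob_map_path glob_map_continuous glob_map_comp.
End GlobeMap.

Definition directed_segment : flow := glob cg_point.

(* [step X b a a'] is the space of paths of [X] from [a] to [a'] if [b] is
   [true], and of states of [X] equal to both [a] and [a'] if [b] is [false]:
   at most one point. *)
Definition step (X : flow) (b : bool) (a a' : state X) : cgspace :=
  if b then epath X a a' else cg_discrete {classic (a = a')}.

Arguments step : clear implicits.

Definition step_comp (X : flow) (b b' : bool) (a a' a'' : state X) :
    step X b a a' -> step X b' a' a'' -> step X (b || b') a a'' :=
  match b, b'
  return step X b a a' -> step X b' a' a'' -> step X (b || b') a a'' with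
  | true, true => fun x y => ecomp x y
  | true, false => fun x e => ecast c (epath X a c) e x
  | false, true => fun e y => ecast c (epath X c a'') (esym e) y
  | false, false => fun e e' => etrans e e'
  end.

Lemma step_comp_continuous (X : flow) (b b' : bool) (a a' a'' : state X) :
  continuous (fun p : cg_prod (step X b a a') (step X b' a' a'') =>
    step_comp p.1 p.2).
Proof.
case: b b' => -[] /=.
- exact: ecomp_continuous.
- move=> p; have e : a' = a'' by case: p.
  subst a''.
  have -> : (fun q : cg_prod (step X true a a') (step X false a' a') =>
    @step_comp X true false a a' a' q.1 q.2) = fun q => q.1.
    apply/funext => -[x e'] /=.
    by rewrite (Prop_irrelevance (e' : a' = a') erefl).
  exact: cg_fst_continuous.
- move=> p; have e : a = a' by case: p.
  subst a'.
  have -> : (fun q : cg_prod (step X false a a) (step X true a a'') =>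
    @step_comp X false true a a a'' q.1 q.2) = fun q => q.2.
    apply/funext => -[e' y] /=.
    by rewrite (Prop_irrelevance (e' : a = a) erefl).
  exact: cg_snd_continuous.
- move=> p.
  have -> : (fun q : cg_prod (step X false a a') (step X false a' a'') =>
    @step_comp X false false a a' a'' q.1 q.2) = fun=> etrans p.1 p.2.
    by apply/funext => q; exact: (@Prop_irrelevance (a = a'')).
  exact: cst_continuous.
Qed.

Lemma step_compA (X : flow) (b b' b'' : bool) (a a' a'' a''' : state X)
    (x : step X b a a') (y : step X b' a' a'') (z : step X b'' a'' a''') :
  ecast c (step X c a a''') (esym (orbA b b' b''))
    (step_comp (step_comp x y) z) =
  step_comp x (step_comp y z).
Proof.
case: b b' b'' x y z => -[] [] x y z; rewrite eq_axiomK /= ?ecompA //.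
- have e : a'' = a''' by [].
  by subst a'''; rewrite (Prop_irrelevance (z : a'' = a'') erefl).
- have e : a' = a'' by [].
  by subst a''; rewrite (Prop_irrelevance (y : a' = a') erefl).
- have e : a' = a'' by [].
  have e' : a'' = a''' by [].
  subst a''' a''; rewrite (Prop_irrelevance (y : a' = a') erefl).
  by rewrite (Prop_irrelevance (z : a' = a') erefl).
- have e : a = a' by [].
  by subst a'; rewrite (Prop_irrelevance (x : a = a) erefl).
- have e : a = a' by [].
  have e' : a'' = a''' by [].
  subst a''' a'; rewrite (Prop_irrelevance (x : a = a) erefl).
  by rewrite (Prop_irrelevance (z : a'' = a'') erefl).
- have e : a = a' by [].
  have e' : a' = a'' by [].
  subst a'' a'; rewrite (Prop_irrelevance (x : a = a) erefl).
  by rewrite (Prop_irrelevance (y : a = a) erefl).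
- exact: (@Prop_irrelevance (a = a''')).
Qed.

Section Tensor.
Variables X Y : flow.

(* Summands of the path space of a tensor product: [(true, true)],
   [(false, true)] and [(true, false)] are respectively the products of the
   path spaces, of the states of [X] by the paths of [Y], and of the paths of
   [X] by the states of [Y]. *)
Definition summand : choiceType := {k : bool * bool | k.1 || k.2}.

Definition tens_state : choiceType := (state X * state Y)%type.

Definition tens_path (p q : tens_state) : cgspace :=
  cg_sum (fun k : summand =>
    cg_prod (step X (val k).1 p.1 q.1) (step Y (val k).2 p.2 q.2)).

Lemma summand_or_subproof (k k' : summand) :
  ((val k).1 || (val k').1) || ((val k).2 || (val k').2).
Proof. by case: k => -[[] []] //=; rewrite orbT. Qed.

Definition summand_or (k k' : summand) : summand :=
  exist _ ((val k).1 || (val k').1, (val k).2 || (val k').2)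
    (summand_or_subproof k k').

Definition tens_comp (p q r : tens_state) (x : tens_path p q)
    (y : tens_path q r) : tens_path p r :=
  existT _ (summand_or (projT1 x) (projT1 y))
    (step_comp (projT2 x).1 (projT2 y).1, step_comp (projT2 x).2 (projT2 y).2).

Lemma tens_comp_continuous (p q r : tens_state) :
  continuous (fun u : cg_prod (tens_path p q) (tens_path q r) =>
    tens_comp u.1 u.2).
Proof.
apply: cg_prod_sum_continuous => k k'.
pose P (k : summand) p q :=
  cg_prod (step X (val k).1 p.1 q.1) (step Y (val k).2 p.2 q.2).
apply: (@cg_prod_continuous (P k p q) (P k' q r)) => K u v hK cu cv.
have cfst (A B : cgspace) (w : K -> cg_prod A B) :
    continuous w -> continuous (fun t => (w t).1).
  move=> cw t; apply: (@continuous_comp _ (cg_prod A B) _ w (fun p => p.1)).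
    exact: cw.
  exact: cg_fst_continuous.
have csnd (A B : cgspace) (w : K -> cg_prod A B) :
    continuous w -> continuous (fun t => (w t).2).
  move=> cw t; apply: (@continuous_comp _ (cg_prod A B) _ w (fun p => p.2)).
    exact: cw.
  exact: cg_snd_continuous.
have c1 : continuous (fun t => step_comp (u t).1 (v t).1).
  move=> t; apply: (@continuous_comp _ (cg_prod (step X (val k).1 p.1 q.1)
      (step X (val k').1 q.1 r.1)) _ (fun t => ((u t).1, (v t).1))
      (fun w => step_comp w.1 w.2)); last exact: step_comp_continuous.
  by apply: cg_pair_continuous => //; exact: cfst.
have c2 : continuous (fun t => step_comp (u t).2 (v t).2).
  move=> t; apply: (@continuous_comp _ (cg_prod (step Y (val k).2 p.2 q.2)
      (step Y (val k').2 q.2 r.2)) _ (fun t => ((u t).2, (v t).2))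
      (fun w => step_comp w.1 w.2)); last exact: step_comp_continuous.
  by apply: cg_pair_continuous => //; exact: csnd.
pose F t : P (summand_or k k') p r :=
  (step_comp (u t).1 (v t).1, step_comp (u t).2 (v t).2).
have cF : continuous F.
  exact: (@cg_pair_continuous (step X _ p.1 r.1) (step Y _ p.2 r.2)).
pose G (w : P (summand_or k k') p r) : tens_path p r :=
  existT (fun k => P k p r) _ w.
have cG : continuous G by exact: (@existT_continuous _ (fun k => P k p r)).
by move=> t; exact: (continuous_comp (cF t) (cG (F t))).
Qed.

Lemma tens_compA (p q r s : tens_state) (x : tens_path p q)
    (y : tens_path q r) (z : tens_path r s) :
  tens_comp (tens_comp x y) z = tens_comp x (tens_comp y z).
Proof.
case: x y z => [k x] [k' y] [k'' z]; rewrite /tens_comp /=.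
rewrite -(step_compA x.1 y.1 z.1) -(step_compA x.2 y.2 z.2).
have mk (b1 b1' b2 b2' : bool) (e1 : b1 = b1') (e2 : b2 = b2') h h'
    (u1 : step X b1 p.1 s.1) (u2 : step Y b2 p.2 s.2) :
    existT (fun k : summand =>
      cg_prod (step X (val k).1 p.1 s.1) (step Y (val k).2 p.2 s.2))
      (exist _ (b1, b2) h) (u1, u2) =
    existT _ (exist _ (b1', b2') h')
      (ecast c (step X c p.1 s.1) e1 u1, ecast c (step Y c p.2 s.2) e2 u2).
  by case: b1' / e1 h'; case: b2' / e2 => h'; rewrite (bool_irrelevance h h').
exact: mk.
Qed.

Definition tensor : flow := Flow tens_comp_continuous tens_compA.
End Tensor.

Definition tensor_pow (X : flow) (n : nat) : flow :=
  iterop n tensor X (set_flow unit).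

Local Open Scope ring_scope.

Section Disks.
Variables (R : realType) (n : nat).

Definition disk_set : set 'rV[R]_n := [set x | \sum_i x 0 i ^+ 2 <= 1].
(* The sphere of dimension [n - 1]; it is empty for [n = 0]. *)
Definition sphere_set : set 'rV[R]_n := [set x | \sum_i x 0 i ^+ 2 = 1].
Definition cube_set : set 'rV[R]_n := [set x | forall i, x 0 i \in `[0, 1]].

Lemma sqr_sum_continuous : continuous (fun x : 'rV[R]_n => \sum_i x 0 i ^+ 2).
Proof.
elim: (index_enum _) => [|i s IHs].
  have -> : (fun x : 'rV[R]_n => \sum_(j <- [::]) x 0 j ^+ 2) = cst 0.
    by apply/funext => x; rewrite big_nil.
  exact: cst_continuous.
have -> : (fun x : 'rV[R]_n => \sum_(j <- i :: s) x 0 j ^+ 2) =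
          (fun x => x 0 i * x 0 i + \sum_(j <- s) x 0 j ^+ 2).
  by apply/funext => x; rewrite big_cons expr2.
move=> x; have ci : (fun y : 'rV[R]_n => y 0 i : R^o) @ x --> (x 0 i : R^o).
  exact: coord_continuous.
apply: cvgD; last exact: IHs; first exact: (@nbhs_filter 'rV[R]_n x).
exact: (cvgM ci ci).
Qed.

Lemma disk_compact : compact disk_set.
Proof.
have cl : closed disk_set.
  apply: (@closed_comp _ _ (fun x : 'rV[R]_n => \sum_i x 0 i ^+ 2)
    [set t | t <= 1]).
    by move=> x _; exact: sqr_sum_continuous.
  exact: closed_le.
have := @rV_compact R n (fun=> `[-1, 1]%classic)
  (fun=> @segment_compact R (-1) 1).
move=> /(subclosed_compact cl); apply => x dx i /=.
rewrite in_itv /= -ler_norml -[leRHS]normr1 -ler_sqr ?nnegrE //.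
rewrite !real_normK ?num_real // expr1n (le_trans _ dx) // (bigD1 i) //= lerDl.
by apply: sumr_ge0 => j _; exact: sqr_ge0.
Qed.

Lemma sphere_compact : compact sphere_set.
Proof.
apply: (subclosed_compact _ disk_compact) => [|x]; last first.
  by rewrite /sphere_set /disk_set /= => ->.
apply: (@closed_comp _ _ (fun x : 'rV[R]_n => \sum_i x 0 i ^+ 2)
    [set t | t = 1]).
  by move=> x _; exact: sqr_sum_continuous.
exact: closed_eq.
Qed.

Lemma cube_compact : compact cube_set.
Proof.
have := @rV_compact R n (fun=> `[0, 1]%classic) (fun=> @segment_compact R 0 1).
by congr compact; rewrite predeqE => x.
Qed.

Lemma rV_hausdorff : hausdorff_space 'rV[R]_n.
Proof. exact: norm_hausdorff. Qed.

Definition disk : cgspace := cg_compact rV_hausdorff disk_compact.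
Definition sphere : cgspace := cg_compact rV_hausdorff sphere_compact.
Definition cube : cgspace := cg_compact rV_hausdorff cube_compact.

Definition cube_boundary : set cube :=
  fun x : set_type cube_set =>
    exists i, set_val x 0 i = 0 \/ set_val x 0 i = 1.

Lemma sphere_disk (x : set_type sphere_set) : disk_set (set_val x).
Proof.
by have := set_valP x; rewrite /disk_set /sphere_set /= => ->.
Qed.

Definition sphere_incl : sphere -> disk :=
  fun x : set_type sphere_set => in_set (sphere_disk x).

Lemma sphere_incl_continuous : continuous sphere_incl.
Proof.
apply: (@continuous_comp_initial (set_type disk_set) (set_type sphere_set)
  'rV[R]_n set_val sphere_incl).
exact: (@set_val_continuous _ sphere_set).
Qed.
End Disks.

Definition interval (R : realType) : cgspace :=
  cg_compact (@Rhausdorff R) (@segment_compact R 0 1).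

Definition ival (R : realType) : interval R -> R :=
  fun t : set_type `[0, 1]%classic => set_val t.

Section Homotopy.
Variable R : realType.

Definition joined (X : cgspace) (x y : X) : Prop :=
  exists c : interval R -> X, [/\ continuous c,
    forall t, ival t = 0 -> c t = x & forall t, ival t = 1 -> c t = y].

Definition homotopic_rel (K X : cgspace) (A : set K) (g h : K -> X) : Prop :=
  exists H : cg_prod (interval R) K -> X, [/\ continuous H,
    forall t p, ival t = 0 -> H (t, p) = g p,
    forall t p, ival t = 1 -> H (t, p) = h p &
    forall t p, A p -> H (t, p) = g p].

Definition cube_loop (X : cgspace) (x : X) (n : nat) (g : cube R n -> X) :
    Prop :=
  continuous g /\ forall p, cube_boundary p -> g p = x.

(* The last two conditions are the bijectivity of the maps induced on the
   homotopy groups, given by cubes relative to their boundary. *)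
Definition weak_homotopy_equivalence (X Y : cgspace) (f : X -> Y) : Prop :=
  [/\ continuous f,
    forall x x', joined (f x) (f x') -> joined x x',
    forall y, exists x, joined (f x) y,
    forall (n : nat) (x : X) (g h : cube R n -> X), (0 < n)%N ->
      cube_loop x g -> cube_loop x h ->
      homotopic_rel (@cube_boundary R n) (f \o g) (f \o h) ->
      homotopic_rel (@cube_boundary R n) g h &
    forall (n : nat) (x : X) (k : cube R n -> Y), (0 < n)%N ->
      cube_loop (f x) k ->
      exists2 g, cube_loop x g &
        homotopic_rel (@cube_boundary R n) (f \o g) k].

Definition serre_fibration (E B : cgspace) (f : E -> B) : Prop :=
  continuous f /\
  forall (n : nat) (H : cg_prod (interval R) (cube R n) -> B)
         (g : cube R n -> E),
    continuous H -> continuous g ->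
    (forall t p, ival t = 0 -> H (t, p) = f (g p)) ->
    exists G : cg_prod (interval R) (cube R n) -> E, [/\ continuous G,
      forall t p, ival t = 0 -> G (t, p) = g p &
      forall q, f (G q) = H q].

Definition weak_S_homotopy_equivalence (X Y : flow) (f : hom X Y) : Prop :=
  bijective (hom0 f) /\ weak_homotopy_equivalence (hom_path f).

Definition flow_fibration (X Y : flow) (f : hom X Y) : Prop :=
  serre_fibration (hom_path f).

Inductive generating_cofibration : forall A B : flow, hom A B -> Prop :=
| GlobCofibration n :
    generating_cofibration (glob_map (@sphere_incl_continuous R n))
| RCofibration :
    generating_cofibration
      (set_hom (X := set_flow unit) (fun _ : bool => tt))
| CCofibration : generating_cofibration (initial_hom (set_flow unit)).

End Homotopy.

Definition is_pushout (A B C D : flow) (f : hom A B) (g : hom A C)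
    (i : hom B D) (j : hom C D) : Prop :=
  i \oh f = j \oh g /\
  forall (E : flow) (u : hom B E) (v : hom C E), u \oh f = v \oh g ->
    exists! w : hom D E, w \oh i = u /\ w \oh j = v.

Definition flow_map_class := forall A B : flow, hom A B -> Prop.

Definition pushout_closure (C : flow_map_class) : flow_map_class :=
  fun X Y j => exists (A B : flow) (f : hom A B) (g : hom A X) (i : hom B Y),
    C A B f /\ is_pushout f g i j.

Record diagram (d : Order.disp_t) (I : orderType d) := Diagram {
  dobj :> I -> flow;
  dmap : forall i j : I, (i <= j)%O -> hom (dobj i) (dobj j);
  dmap_id : forall (i : I) (h : (i <= i)%O), dmap h = id_hom (dobj i);
  dmap_comp : forall (i j k : I) (h : (i <= j)%O) (h' : (j <= k)%O)
    (h'' : (i <= k)%O), dmap h'' = dmap h' \oh dmap h }.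

(* [c] is a colimit cocone of the restriction of [F] to [P]. *)
Definition is_colimit (d : Order.disp_t) (I : orderType d) (F : diagram I)
    (P : pred I) (X : flow) (c : forall i, P i -> hom (F i) X) : Prop :=
  (forall i j (Pi : P i) (Pj : P j) (h : (i <= j)%O),
     c j Pj \oh dmap F h = c i Pi) /\
  forall (E : flow) (v : forall i, P i -> hom (F i) E),
    (forall i j (Pi : P i) (Pj : P j) (h : (i <= j)%O),
       v j Pj \oh dmap F h = v i Pi) ->
    exists! w : hom X E, forall i (Pi : P i), w \oh c i Pi = v i Pi.

Definition is_successor (d : Order.disp_t) (I : orderType d) (i j : I) : Prop :=
  (i < j)%O /\ forall k : I, (i < k)%O -> (j <= k)%O.

(* The nonempty well-ordered type [I], with least element [i0], plays the role
   of the ordinal indexing the transfinite sequence. *)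
Definition transfinite_composition (C : flow_map_class) : flow_map_class :=
  fun A B f =>
  exists (d : Order.disp_t) (I : orderType d) (i0 : I) (F : diagram I)
    (a : hom A (F i0)) (c : forall i, predT i -> hom (F i) B),
  [/\ well_founded (fun i j : I => (i < j)%O) /\ (forall i, (i0 <= i)%O),
    forall (i j : I) (h : (i <= j)%O), is_successor i j -> C _ _ (dmap F h),
    forall j : I, j <> i0 -> (forall i, ~ is_successor i j) ->
      is_colimit (P := fun i => (i < j)%O) (fun i h => dmap F (ltW h)),
    is_colimit c &
    is_iso a /\ f = c i0 isT \oh a].

Definition cell (R : realType) (X : flow) : Prop :=
  transfinite_composition (pushout_closure (@generating_cofibration R))
    (initial_hom X).

(* The model structure determines the functor only up to the choice of a
   functorial factorization of the maps from the initial flow as a cell complex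
   followed by a trivial fibration. *)
Record cofibrant_replacement (R : realType) := CofibrantReplacement {
  Qobj :> flow -> flow;
  Qmap : forall X Y : flow, hom X Y -> hom (Qobj X) (Qobj Y);
  Qmap_id : forall X, Qmap (id_hom X) = id_hom (Qobj X);
  Qmap_comp : forall (X Y Z : flow) (g : hom Y Z) (f : hom X Y),
    Qmap (g \oh f) = Qmap g \oh Qmap f;
  Qcell : forall X, cell R (Qobj X);
  Qproj : forall X, hom (Qobj X) X;
  Qproj_natural : forall (X Y : flow) (f : hom X Y),
    Qproj Y \oh Qmap f = f \oh Qproj X;
  Qproj_weak_equivalence : forall X, weak_S_homotopy_equivalence R (Qproj X);
  Qproj_fibration : forall X, flow_fibration R (Qproj X) }.

Definition full_cube (R : realType) (Q : cofibrant_replacement R) (n : nat) :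
  flow := Q (tensor_pow directed_segment n).

(* A homotopy is a continuous map from the product of the interval with [X],
   including its discrete space of states, that is a morphism of flows at each
   time; it is therefore constant on states. *)
Definition S_homotopic (R : realType) (X Y : flow) (f g : hom X Y) : Prop :=
  exists H : interval R -> hom X Y, [/\
    forall t, ival t = 0 -> H t = f,
    forall t, ival t = 1 -> H t = g,
    forall t a, hom0 (H t) a = hom0 f a &
    continuous (fun q : cg_prod (interval R) (path_space X) =>
      hom_path (H q.1) q.2)].

Definition S_homotopy_equivalence (R : realType) (X Y : flow) (f : hom X Y) :
    Prop :=
  exists g : hom Y X,
    S_homotopic R (g \oh f) (id_hom X) /\ S_homotopic R (f \oh g) (id_hom Y).

Section Restriction.
Variables (Y : flow) (A : set (state Y)).

Definition restriction : flow :=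
  @Flow (set_type A) (fun a b => epath Y (set_val a) (set_val b))
    (fun a b c x y => ecomp x y)
    (fun a b c => @ecomp_continuous Y _ _ _)
    (fun a b c d x y z => @ecompA Y _ _ _ _ x y z).
End Restriction.

Definition corestriction (X Y : flow) (f : hom X Y) :
    hom X (restriction (range (hom0 f))) :=
  @Hom X (restriction (range (hom0 f)))
    (fun a => in_set (imageT (hom0 f) a)) (fun a b x => homP f x)
    (fun a b => @homP_continuous X Y f a b)
    (fun a b c x y => @homP_comp X Y f a b c x y).

(* The quotient in the category of compactly generated spaces is characterized
   by its universal property: it is in general a further quotient of the
   topological one, which need not be weak Hausdorff. *)
Definition is_cg_quotient (T : cgspace) (E : T -> T -> Prop) (Z : cgspace)
    (q : T -> Z) : Prop :=
  [/\ continuous q, forall x y, E x y -> q x = q y &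
    forall (W : cgspace) (h : T -> W), continuous h ->
      (forall x y, E x y -> h x = h y) ->
      exists! k : Z -> W, continuous k /\ forall x, k (q x) = h x].

Definition equivalence_closure (T : Type) (E : T -> T -> Prop) :
  T -> T -> Prop := @Relation_Operators.clos_refl_sym_trans T E.

Section Branching.
Variables (Y : flow) (a : state Y).

Definition paths_from : cgspace := cg_sum (fun b => epath Y a b).
Definition paths_to : cgspace := cg_sum (fun b => epath Y b a).

Definition branching_step (p q : paths_from) : Prop :=
  exists (b c : state Y) (x : epath Y a b) (y : epath Y b c),
    p = existT _ b x /\ q = existT _ c (ecomp x y).

Definition merging_step (p q : paths_to) : Prop :=
  exists (b c : state Y) (x : epath Y b c) (y : epath Y c a),
    p = existT _ c y /\ q = existT _ b (ecomp x y).

Definition is_branching_space (Z : cgspace) : Prop :=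
  exists q : paths_from -> Z,
    is_cg_quotient (equivalence_closure branching_step) q.

Definition is_merging_space (Z : cgspace) : Prop :=
  exists q : paths_to -> Z,
    is_cg_quotient (equivalence_closure merging_step) q.
End Branching.

Definition is_singleton (Z : Type) : Prop := exists z : Z, forall z', z' = z.

Definition T_homotopy_equivalence (X Y : flow) (f : hom X Y) : Prop :=
  [/\ is_iso (corestriction f),
    forall a, ~ range (hom0 f) a ->
      (exists2 Z, is_branching_space a Z & is_singleton Z) /\
      (exists2 Z, is_merging_space a Z & is_singleton Z) &
    forall a, ~ range (hom0 f) a ->
      (exists b, inhabited (epath Y (hom0 f b) a)) /\
      (exists c, inhabited (epath Y a (hom0 f c)))].

(* Main.v *)
From mathcomp Require Import all_boot all_order all_algebra.
From mathcomp Require Import all_classical reals topology normedtype numfun.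
From mathcomp Require Import lra.
Require Import Defs.

(* Call a flow crowned if it has states a_0, a_1, a_2, b_0, b_1, b_2 such that
   there is a path from a_i to b_j if and only if i <> j. The full n-cube with
   n >= 3 is crowned (take the atoms and coatoms of three coordinates), the
   directed segment is not, and both kinds of equivalences preserve and reflect
   this property, which only depends on the relation "there is a path from a to
   b" on states. The only nontrivial case is that of a T-homotopy equivalence
   X -> Y with Y crowned. If P^-_y Y is a singleton and Y is a cell complex, all
   the paths starting at y go through one and the same state c; a_i = y can then
   be replaced by c, and finitely many such steps lead to a state of X. The b_j
   are treated dually.

   The state c comes from homotopy-free information extracted from morphisms of
   Y to one-state flows whose path space is the real line with an associative
   law. As a continuous map from a sphere to the line extends to the disk, such
   morphisms can be built cell by cell. For the law |x| + |y| + 1 they show that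
   a path is a composite of indecomposable ones; for the law x * y = x they are
   constant on the paths of origin y if P^-_y Y is a singleton, although they
   separate the indecomposable paths of Y. *)

Set Implicit Arguments.
Unset Strict Implicit.
Unset Printing Implicit Defensive.

Import Order.TTheory GRing.Theory Num.Theory.
Import numFieldNormedType.Exports.

Local Open Scope classical_set_scope.
Local Open Scope ring_scope.

(** * The real line as a compactly generated space *)

Section Line.
Variable R : realType.

Lemma line_weak_hausdorff : weak_hausdorff R.
Proof.
move=> K u [cK _] cu; apply: compact_closed; first exact: Rhausdorff.
by apply: continuous_compact => //; exact: continuous_subspaceT.
Qed.

(** Each [x] has the compact neighborhood [[x - 1, x + 1]], and testing a k-open set on it already
    gives openness at [x]. *)
Lemma line_k_space : k_space R.
Proof.
move=> A kA; rewrite openE => x Ax; rewrite /interior.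
pose J := `[x - 1, x + 1]%classic : set R.
have Jx : J x by rewrite /J /= in_itv /= gerBl lerDl ler01.
have hJ : compact_hausdorff (set_type J).
  split; last exact/set_type_hausdorff/Rhausdorff.
  exact/set_type_compact/segment_compact.
have [W oW WA] := kA _ (set_val : set_type J -> R) hJ (@set_val_continuous _ J).
have Wx : W x.
  suff : (set_val @^-1` W : set (set_type J)) (in_set Jx) by [].
  by rewrite WA.
have nJ : nbhs x (J : set R).
  have : x \in `]x - 1, x + 1[ by rewrite in_itv /= gtrBl ltrDl ltr01.
  move=> /near_in_itvoo; apply: filterS => y; exact: subset_itv_oo_cc.
apply: filterS2 nJ (open_nbhs_nbhs (conj oW Wx)) => y Jy Wy.
suff : (set_val @^-1` A : set (set_type J)) (in_set Jy) by [].
by rewrite -WA.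
Qed.

Definition line : cgspace := CGSpace line_weak_hausdorff line_k_space.

End Line.

(** * One-state flows given by a continuous associative law *)

Section SemigroupFlow.
Variables (W : cgspace) (op : W -> W -> W).
Hypothesis op_continuous : continuous (fun p : cg_prod W W => op p.1 p.2).
Hypothesis opA : associative op.

Definition semigroup_flow : flow :=
  @Flow unit (fun _ _ => W) (fun _ _ _ => op) (fun _ _ _ => op_continuous)
    (fun _ _ _ _ x y z => esym (opA x y z)).

Definition value (X : flow) (h : hom X semigroup_flow) (p : path_space X) : W :=
  homP h (projT2 p).

Lemma semigroup_hom_eq (X : flow) (h h' : hom X semigroup_flow) :
  (forall p, value h p = value h' p) -> h = h'.
Proof.
case: h h' => h0 hP hc hm [h0' hP' hc' hm'] e.
have e0 : h0 = h0' by apply/funext => a; case: (h0 a); case: (h0' a).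
subst h0'.
have eP : hP = hP'.
  apply: functional_extensionality_dep => a.
  apply: functional_extensionality_dep => b; apply/funext => x.
  exact: (e (existT _ (a, b) x)).
subst hP'; congr Hom; exact: Prop_irrelevance.
Qed.

Lemma value_comp (X Y : flow) (h : hom Y semigroup_flow) (f : hom X Y) p :
  value (h \oh f) p = value h (hom_path f p).
Proof. by []. Qed.

Section GlobValue.
Variables (Z : cgspace) (f : Z -> W).
Hypothesis cf : continuous f.

Definition glob_value_path (a b : bool) : glob_path Z a b -> W :=
  match a, b return glob_path Z a b -> W with
  | false, true => f
  | _, _ => fun x => match x : void with end
  end.

Lemma glob_value_continuous (a b : bool) : continuous (@glob_value_path a b).
Proof. by case: a b => -[] //=; case. Qed.

Lemma glob_value_comp (a b c : bool) (x : glob_path Z a b)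
    (y : glob_path Z b c) :
  glob_value_path (glob_comp x y) = op (glob_value_path x) (glob_value_path y).
Proof. by case: a b x y => -[] x y; [case: x|case: x|case: y|case: x]. Qed.

(** No two paths of a globe compose, so every continuous function on [Z] gives a morphism, whatever
    the law. *)
Definition glob_value : hom (glob Z) semigroup_flow :=
  @Hom (glob Z) semigroup_flow (fun=> tt) glob_value_path
    glob_value_continuous glob_value_comp.
End GlobValue.

End SemigroupFlow.

(** * Extending and perturbing real functions on disks *)

Section DiskExtension.
Variables (R : realType) (n : nat).

(** Tietze's theorem: the sphere is closed in the normal space ['rV[R]_n], and [f] is bounded by
    compactness. *)
Lemma sphere_extension (f : sphere R n -> line R) :
  continuous f ->
  exists2 g : disk R n -> line R, continuous g & g \o @sphere_incl R n = f.
Proof.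
move=> cf.
have clS : closed (@sphere_set R n).
  by apply: compact_closed (@sphere_compact R n); exact: rV_hausdorff.
have [M M0 fM] : exists2 M : R, 0 < M & forall x : sphere R n, `|f x : R| <= M.
  have cS : compact [set: sphere R n] by exact/set_type_compact/sphere_compact.
  have : compact (range (f : sphere R n -> R)).
    by apply: continuous_compact => //; exact: continuous_subspaceT.
  move=> /compact_bounded [M0 [_ M0f]].
  exists (`|M0| + 1); first by rewrite ltr_wpDl.
  move=> x; apply: M0f; last by exists x.
  by rewrite (le_lt_trans (ler_norm _)) // ltrDl.
pose F : 'rV[R]_n -> R := valL_ (0 : R) (f : set_type (@sphere_set R n) -> R).
have cF : {within @sphere_set R n, continuous F}.
  exact/subspace_valL_continuousP'.
have FE x : F (set_val x) = f x.
  have := @valLK _ _ (0 : R) (@sphere_set R n) f.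
  by move/(congr1 (fun h => h x)).
have FM x : sphere_set x -> `|F x| <= M.
  by move=> Sx; rewrite -[x]/(set_val (in_set Sx)) FE; exact: fM.
have [g [gF cg _]] :=
  continuous_bounded_extension (@pseudometric_normal R 'rV[R]_n) clS M0 cF FM.
exists (fun x : set_type (@disk_set R n) => g (set_val x)).
  move=> x; apply: continuous_comp; last exact: cg.
  exact: set_val_continuous.
apply/funext => x /=; rewrite -FE gF //; apply: mem_set; exact: (set_valP x).
Qed.

(** On the disk, [1 - N] vanishes exactly on the sphere; the squared distance to [y] is a second
    factor that kills the value at [y] when [y <> x]. *)
Lemma disk_bump (x y : disk R n) :
  (forall z, sphere_incl z <> x) ->
  exists g : disk R n -> R, [/\ continuous g,
    forall z, g (sphere_incl z) = 0, y <> x -> g y = 0 & g x <> 0].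
Proof.
move=> xS.
pose N (v : 'rV[R]_n) : R := \sum_i v 0 i ^+ 2.
have cN : continuous N := @sqr_sum_continuous R n.
pose v (z : disk R n) : 'rV[R]_n := set_val (z : set_type (@disk_set R n)).
have cv : continuous v by exact: set_val_continuous.
pose g z := 1 - N (v z).
have cg : continuous g.
  move=> z; apply: (@continuousB R R^o _ (cst 1) (N \o v) z).
    exact: cst_continuous.
  by apply: continuous_comp; [exact: cv|exact: cN].
have gS z : g (sphere_incl z) = 0.
  by rewrite /g /N /v /= /sphere_incl /= (set_valP z) subrr.
have gx : g x <> 0.
  move/eqP; rewrite subr_eq0 => /eqP Nx.
  by apply: (xS (in_set (esym Nx))); exact: val_inj.
have [yx|yx] := pselect (y = x); first by exists g; split.
exists (fun z => g z * N (v z - v y)); split.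
- move=> z; apply: (@continuousM R (disk R n)); first exact: cg.
  apply: (continuous_comp (f := fun z => v z - v y)); last exact: cN.
  by apply: (@continuousB R 'rV[R]_n); [exact: cv|exact: cst_continuous].
- by move=> z; rewrite gS mul0r.
- rewrite subrr [N 0]big1 ?mulr0 // => i _.
  by rewrite mxE expr0n.
apply/eqP; rewrite mulf_neq0 //; first exact/eqP.
apply/eqP => /psumr_eq0P e; apply: yx; apply: val_inj; apply/rowP => i.
apply/eqP; rewrite eq_sym -subr_eq0 -sqrf_eq0.
by have := e (fun i _ => sqr_ge0 _) i isT; rewrite !mxE => ->.
Qed.
End DiskExtension.

(** * Equality of morphisms of flows *)

Lemma hom_ext (X Y : flow) (f g : hom X Y) :
  (forall a, hom0 f a = hom0 g a) ->
  (forall p, hom_path f p = hom_path g p) -> f = g.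
Proof.
case: f g => f0 fP fc fm [g0 gP gc gm] /= /funext e; subst g0 => e.
have eP : fP = gP.
  apply: functional_extensionality_dep => a.
  apply: functional_extensionality_dep => b; apply/funext => x.
  exact: existT_inj2 (e (existT _ (a, b) x)).
by subst gP; congr Hom; exact: Prop_irrelevance.
Qed.

Lemma comp_homA (X Y Z T : flow) (h : hom Z T) (g : hom Y Z) (f : hom X Y) :
  h \oh g \oh f = h \oh (g \oh f).
Proof. exact: hom_ext. Qed.

Lemma hom_path_id (X : flow) (p : path_space X) : hom_path (id_hom X) p = p.
Proof. by case: p => -[]. Qed.

Lemma comp_id_hom (X Y : flow) (f : hom X Y) : id_hom Y \oh f = f.
Proof. by apply: hom_ext. Qed.

Lemma comp_hom_id (X Y : flow) (f : hom X Y) : f \oh id_hom X = f.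
Proof. by apply: hom_ext. Qed.

(** * Subspaces and subflows *)

Section Subspace.
Variables (X : cgspace) (A : set X).

Lemma kify_sub_weak_hausdorff : weak_hausdorff (kify (set_type A)).
Proof.
move=> K u hK cu; rewrite -[X in closed X]setCK; apply: open_closedC.
rewrite kify_openE => L v hL cv; rewrite preimage_setC; apply: closed_openC.
have cv' : continuous ((set_val : set_type A -> X) \o v).
  by move=> l; apply: continuous_comp; [exact: cv|exact: set_val_continuous].
have cu' : continuous ((set_val : set_type A -> X) \o u).
  move=> l; apply: continuous_comp; last exact: set_val_continuous.
  exact: of_kify_continuous cu l.
have E : v @^-1` range u = (set_val \o v) @^-1` range (set_val \o u).
  rewrite predeqE => l; split=> -[k _ e]; exists k => //=; first by rewrite e.
  exact: val_inj.
suff : closed ((set_val \o v) @^-1` range (set_val \o u)) by rewrite -E.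
apply: closed_comp; first by move=> l _; exact: cv'.
exact: cg_weak_hausdorff hK cu'.
Qed.

(** [A] is arbitrary, so its subspace topology need not be compactly generated; hence the refinement
    by k-open sets. *)
Definition cg_sub : cgspace :=
  CGSpace kify_sub_weak_hausdorff (@kify_k_space (set_type A)).

Definition sub_val (x : cg_sub) : X := set_val (x : set_type A).

Lemma sub_val_continuous : continuous sub_val.
Proof.
move=> x.
apply: (continuous_comp (f := id : kify (set_type A) -> set_type A)).
  exact: from_kify_continuous.
exact: set_val_continuous.
Qed.

Lemma sub_continuous (Z : cgspace) (f : Z -> cg_sub) :
  continuous (sub_val \o f) -> continuous f.
Proof.
move=> cf; apply/continuousP => O kO; apply: cg_k_space => K u hK cu.
apply: (kO K (f \o u)) => //.
apply: (@continuous_comp_initial _ _ _ (set_val : set_type A -> X)) => k.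
by apply: (continuous_comp (f := u) (g := sub_val \o f));
  [exact: cu|exact: cf].
Qed.
End Subspace.

Section Subflow.
Variables (X : flow) (S : set (path_space X)).

Definition mkpath (a b : state X) (x : epath X a b) : path_space X :=
  existT (fun ab : state X * state X => epath X ab.1 ab.2 : Type) (a, b) x.

Hypothesis S_comp : forall a b c (x : epath X a b) (y : epath X b c),
  S (mkpath x) -> S (mkpath y) -> S (mkpath (ecomp x y)).

Definition subflow_path (a b : state X) : cgspace :=
  cg_sub [set x : epath X a b | S (mkpath x)].

Definition subflow_comp (a b c : state X) (x : subflow_path a b)
    (y : subflow_path b c) : subflow_path a c :=
  in_set (S_comp (set_valP x) (set_valP y)).

Lemma subflow_comp_continuous (a b c : state X) :
  continuous (fun p : cg_prod (subflow_path a b) (subflow_path b c) =>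
    subflow_comp p.1 p.2).
Proof.
apply: sub_continuous.
apply: (@cg_prod_continuous (subflow_path a b) (subflow_path b c)).
move=> K u v hK cu cv k.
apply: (continuous_comp
  (f := fun k => (sub_val (u k), sub_val (v k)) :
    cg_prod (epath X a b) (epath X b c))
  (g := fun p : cg_prod (epath X a b) (epath X b c) => ecomp p.1 p.2));
  last exact: ecomp_continuous.
apply: cg_pair_continuous => // l.
  by apply: continuous_comp; [exact: cu|exact: sub_val_continuous].
by apply: continuous_comp; [exact: cv|exact: sub_val_continuous].
Qed.

Lemma subflow_compA (a b c d : state X) (x : subflow_path a b)
    (y : subflow_path b c) (z : subflow_path c d) :
  subflow_comp (subflow_comp x y) z = subflow_comp x (subflow_comp y z).
Proof. by apply: val_inj; exact: ecompA. Qed.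

Definition subflow : flow := Flow subflow_comp_continuous subflow_compA.

Definition subflow_incl : hom subflow X :=
  @Hom subflow X id (fun a b x => sub_val x)
    (fun a b => @sub_val_continuous _ _) (fun a b c x y => erefl).

Lemma subflow_incl_mem (p : path_space subflow) : S (hom_path subflow_incl p).
Proof. by case: p => -[a b] x; exact: (set_valP x). Qed.

Lemma subflow_incl_inj : injective (hom_path subflow_incl).
Proof.
move=> [[a b] x] [[a' b'] x'] e.
have /= [ea eb] := congr1 (@projT1 _ _) e.
move: x' e; rewrite -ea -eb => x' e.
by congr existT; apply: val_inj; exact: existT_inj2 e.
Qed.

Lemma subflow_incl_mono (Z : flow) (u v : hom Z subflow) :
  subflow_incl \oh u = subflow_incl \oh v -> u = v.
Proof.
move=> e; apply: hom_ext => [a|p].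
  exact: (congr1 (fun h => hom0 h a) e).
exact/subflow_incl_inj/(congr1 (fun h => hom_path h p) e).
Qed.

Section Lift.
Variables (Z : flow) (f : hom Z X).
Hypothesis Sf : forall p, S (hom_path f p).

Definition lift_path (a b : state Z) (x : epath Z a b) :
    subflow_path (hom0 f a) (hom0 f b) :=
  in_set (Sf (existT _ (a, b) x)).

Lemma lift_path_continuous (a b : state Z) : continuous (@lift_path a b).
Proof. apply: sub_continuous; exact: homP_continuous. Qed.

Lemma lift_path_comp (a b c : state Z) (x : epath Z a b) (y : epath Z b c) :
  lift_path (ecomp x y) = subflow_comp (lift_path x) (lift_path y).
Proof. by apply: val_inj; exact: homP_comp. Qed.

Definition subflow_lift : hom Z subflow :=
  @Hom Z subflow (hom0 f) lift_path lift_path_continuous lift_path_comp.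

Lemma subflow_liftK : subflow_incl \oh subflow_lift = f.
Proof. exact: hom_ext. Qed.
End Lift.

Lemma subflow_section (w : hom X subflow) :
  subflow_incl \oh w = id_hom X -> forall p, S p.
Proof.
move=> e p; rewrite -[p]hom_path_id -e; exact: subflow_incl_mem (hom_path w p).
Qed.
End Subflow.

(** * Indecomposable paths in pushouts and colimits *)

Definition decomposable (X : flow) (p : path_space X) : Prop :=
  exists (a b c : state X) (x : epath X a b) (y : epath X b c),
    p = mkpath (ecomp x y).

Lemma indecomposable_compl (X : flow) (p : path_space X) :
  ~ decomposable p ->
  forall a b c (x : epath X a b) (y : epath X b c),
    (~` [set p]) (mkpath x) -> (~` [set p]) (mkpath y) ->
    (~` [set p]) (mkpath (ecomp x y)).
Proof. by move=> ip a b c x y _ _ e; apply: ip; exists a, b, c, x, y. Qed.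

(* Otherwise all the paths of [D] but [p] form a subflow through which [i] and
   [j] factor, so that the identity of [D] factors through it. *)
Lemma pushout_indecomposable (A B C D : flow) (f : hom A B) (g : hom A C)
    (i : hom B D) (j : hom C D) (p : path_space D) :
  is_pushout f g i j -> ~ decomposable p ->
  (exists q, hom_path i q = p) \/ (exists q, hom_path j q = p).
Proof.
move=> [ifjg univ] ip; apply: contrapT => /not_orP [/forallNP pi /forallNP pj].
have cS := indecomposable_compl ip.
have [|w [[wi wj] _]] := univ _ (subflow_lift cS pi) (subflow_lift cS pj).
  by apply: subflow_incl_mono; rewrite -!comp_homA !subflow_liftK.
(* Uniqueness for the cocone [i], [j] itself identifies the composite through the subflow with
   [id_hom D]. *)
have [h [_ hu]] := univ _ i j ifjg.
suff /subflow_section/(_ p) : subflow_incl cS \oh w = id_hom D by exact.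
have <- : h = id_hom D by apply: hu; rewrite !comp_id_hom.
by apply/esym/hu; rewrite !comp_homA wi wj !subflow_liftK.
Qed.

(** As for pushouts: if [p] came from no stage, the identity of [X] would factor through the subflow
    of the other paths. *)
Lemma colimit_indecomposable (d : Order.disp_t) (I : orderType d)
    (F : diagram I) (P : pred I) (X : flow) (c : forall i, P i -> hom (F i) X)
    (p : path_space X) :
  is_colimit c -> ~ decomposable p ->
  exists (i : I) (Pi : P i) (q : path_space (F i)), hom_path (c i Pi) q = p.
Proof.
move=> [cF univ] ip; apply: contrapT => np.
have pc i Pi q : hom_path (c i Pi) q <> p.
  by move=> e; apply: np; exists i, Pi, q.
have cS := indecomposable_compl ip.
have [|w [wc _]] := univ _ (fun i Pi => subflow_lift cS (pc i Pi)).
  move=> i j Pi Pj h; apply: subflow_incl_mono.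
  by rewrite -comp_homA !subflow_liftK cF.
have [h [_ hu]] := univ X c cF.
suff /subflow_section/(_ p) : subflow_incl cS \oh w = id_hom X by exact.
have <- : h = id_hom X by apply: hu => i Pi; rewrite comp_id_hom.
by apply/esym/hu => i Pi; rewrite comp_homA wc subflow_liftK.
Qed.

Lemma le_split (d : Order.disp_t) (I : orderType d) (k l : I) :
  (k <= l)%O -> k = l \/ (k < l)%O.
Proof. by rewrite le_eqVlt => /predU1P. Qed.

(** * Extension of morphisms cell by cell *)

Section CellExtension.
Variables (R : realType) (op : line R -> line R -> line R).
Hypothesis op_continuous :
  continuous (fun p : cg_prod (line R) (line R) => op p.1 p.2).
Hypothesis opA : associative op.

Local Notation E := (semigroup_flow op_continuous opA).

(** For globes, this is extension from the sphere to the disk; the two other cofibrations involve no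
    paths, and [E] has a single state. *)
Lemma generating_extension (A B : flow) (f : hom A B) (u : hom A E) :
  generating_cofibration R f -> exists w : hom B E, w \oh f = u.
Proof.
move=> Cf; case: Cf u => [n||] u; last 2 first.
- exists (@set_hom unit E id); apply: semigroup_hom_eq => -[? []].
- exists (@set_hom unit E id); apply: semigroup_hom_eq => -[? []].
have [g cg gE] := sphere_extension (@homP_continuous _ _ u false true).
exists (glob_value op_continuous opA cg).
apply: semigroup_hom_eq => -[[[] []] x] //=.
exact: (congr1 (fun h => h x) gE).
Qed.

Lemma pushout_extension (X Y : flow) (j : hom X Y) (v : hom X E) :
  pushout_closure (@generating_cofibration R) j ->
  exists w : hom Y E, w \oh j = v.
Proof.
move=> [A [B [f [g [i [Cf [_ univ]]]]]]].
have [u uf] := generating_extension (v \oh g) Cf.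
by have [w [[_ wj] _]] := univ _ u v uf; exists w.
Qed.

Lemma glob_bump (n : nat) (w : hom (glob (disk R n)) E) (x y : disk R n) :
  (forall z, sphere_incl z <> x) ->
  exists w' : hom (glob (disk R n)) E,
    [/\ w' \oh glob_map (@sphere_incl_continuous R n) =
        w \oh glob_map (@sphere_incl_continuous R n),
      y <> x -> @homP _ _ w' false true y = @homP _ _ w false true y &
      @homP _ _ w' false true x <> @homP _ _ w false true x].
Proof.
move=> xS; have [g [cg gS gy gx]] := disk_bump y xS.
pose h (z : disk R n) : line R := @homP _ _ w false true z + g z.
have ch : continuous h.
  move=> z; apply: (@continuousD R R^o _ (@homP _ _ w false true) g);
    last exact: cg.
  exact: (@homP_continuous _ _ w false true).
exists (glob_value op_continuous opA ch); split => /=.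
- by apply: semigroup_hom_eq => -[[[] []] z] //=; rewrite /value /= /h gS addr0.
- by move=> /gy e; rewrite /h e addr0.
- by move/eqP; rewrite /h -subr_eq0 addrAC subrr add0r => /eqP.
Qed.

Section Stages.
Variables (d : Order.disp_t) (I : orderType d) (i0 : I) (F : diagram I).
Variables (Y : flow) (c : forall i, predT i -> hom (F i) Y).
Hypothesis wfI : well_founded (fun i j : I => (i < j)%O).
Hypothesis i0_le : forall i : I, (i0 <= i)%O.
Hypothesis succF : forall (i j : I) (h : (i <= j)%O), is_successor i j ->
  pushout_closure (@generating_cofibration R) (dmap F h).
Hypothesis limF : forall j : I, j <> i0 -> (forall i, ~ is_successor i j) ->
  is_colimit (P := fun i => (i < j)%O) (fun i h => dmap F (ltW h)).
Hypothesis colimF : is_colimit c.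

Section Extend.
Variables (i : I) (v : hom (F i) E).

(** The transfinite recursion choosing extensions is defined before they are known to exist, hence
    [option]. The choice at [j] must restrict to all earlier ones and come from [v] while
    [j <= i]. *)
Let extends (j : I) (prev : forall k, (k < j)%O -> option (hom (F k) E))
    (w : hom (F j) E) : Prop :=
  (forall k (h : (k < j)%O), prev k h = Some (w \oh dmap F (ltW h))) /\
  forall h : (j <= i)%O, w = v \oh dmap F h.

Let next (j : I) (prev : forall k, (k < j)%O -> option (hom (F k) E)) :
    option (hom (F j) E) :=
  if pselect (exists w, extends prev w) is left ex
  then Some (projT1 (cid ex)) else None.

Let family : forall j, option (hom (F j) E) :=
  Fix wfI (fun j => option (hom (F j) E)) next.

Let familyE j : family j = next (fun k (_ : (k < j)%O) => family k).
Proof.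
apply: Fix_eq => k f g fg; congr next.
apply: functional_extensionality_dep => l.
exact/functional_extensionality_dep/fg.
Qed.

Let family_some j w : family j = Some w ->
  extends (fun k (_ : (k < j)%O) => family k) w.
Proof.
by rewrite familyE /next; case: pselect => // ex [<-]; case: cid.
Qed.

Let family_total j : exists w, family j = Some w.
Proof.
elim/(well_founded_ind wfI): j => j IH.
suff ex : exists w, extends (fun k (_ : (k < j)%O) => family k) w.
  rewrite familyE /next; case: pselect => // ex'.
  by exists (projT1 (cid ex')).
have {}IH k (h : (k < j)%O) : {w | family k = Some w} by exact: cid (IH k h).
pose u k h := projT1 (IH k h).
have uE k h : family k = Some (u k h) by rewrite /u; case: (IH k h).
have u_comp k l hk hl (h : (k <= l)%O) : u l hl \oh dmap F h = u k hk.
  have [e|kl] := le_split h.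
    move: hl h; rewrite -e => hl h.
    by rewrite dmap_id comp_hom_id (bool_irrelevance hk hl).
  have [/(_ k kl) + _] := family_some (uE l hl).
  by rewrite (uE k hk) (bool_irrelevance h (ltW kl)) => -[->].
have u_base k hk (h : (k <= i)%O) : u k hk = v \oh dmap F h.
  by have [_ ->] := family_some (uE k hk).
(* Up to stage [i] the choice is a restriction of [v]; beyond, a successor stage is a pushout and a
   limit stage a colimit. *)
case: (leP j i) => [ji|ij].
  exists (v \oh dmap F ji); split=> [k h|h]; last first.
    by rewrite (bool_irrelevance h ji).
  have ki : (k <= i)%O by exact: le_trans (ltW h) ji.
  rewrite (uE k h) (u_base k h ki); congr Some.
  by rewrite comp_homA -(dmap_comp F (ltW h) ji ki).
have nji (h : (j <= i)%O) w : w = v \oh dmap F h.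
  by have := h; rewrite leNgt ij.
have [[k kj]|nsucc] := pselect (exists k, is_successor k j).
  have kj' := kj.1.
  have [w wE] := pushout_extension (u k kj') (succF (ltW kj') kj).
  exists w; split=> // l lj; rewrite (uE l lj); congr Some.
  have lk : (l <= k)%O.
    by rewrite leNgt; apply/negP => /kj.2; rewrite leNgt lj.
  rewrite (dmap_comp F lk (ltW kj') (ltW lj)) -comp_homA wE.
  by rewrite (u_comp l k lj kj').
have nj0 : j <> i0.
  by move=> e; move: ij; rewrite e ltNge i0_le.
have [|_ univ] := limF nj0.
  by move=> k kj; apply: nsucc; exists k.
have [|w [wE _]] := univ E u; first by move=> k l kj lj h; exact: u_comp.
exists w; split=> // k kj; rewrite (uE k kj); congr Some; exact/esym/wE.
Qed.

Lemma stage_extension : exists w : hom Y E, w \oh c (i := i) isT = v.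
Proof.
pose u k := projT1 (cid (family_total k)).
have uE k : family k = Some (u k) by rewrite /u; case: cid.
have [_ univ] := colimF.
have [|w [wE _]] := univ E (fun k _ => u k).
  move=> k l _ _ h; have [e|kl] := le_split h.
    by move: h; rewrite -e => h; rewrite dmap_id comp_hom_id.
  have [/(_ k kl) + _] := family_some (uE l).
  by rewrite uE (bool_irrelevance h (ltW kl)) => -[->].
exists w; rewrite wE.
have [_ ->//] := family_some (uE i).
by rewrite dmap_id comp_hom_id.
Qed.
End Extend.
End Stages.
End CellExtension.

(** * Separation of indecomposable paths *)

Section CellSeparation.
Variables (R : realType) (op : line R -> line R -> line R).
Hypothesis op_continuous :
  continuous (fun p : cg_prod (line R) (line R) => op p.1 p.2).
Hypothesis opA : associative op.

Local Notation E := (semigroup_flow op_continuous opA).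

(** Stage [i0] is isomorphic to the empty flow, so there is a morphism to start from. *)
Lemma cell_hom (Y : flow) : cell R Y -> inhabited (hom Y E).
Proof.
move=> [d [I [i0 [F [a [c [[wf i0P] sF lF cF [[b _] _]]]]]]]].
have [w _] := stage_extension wf i0P sF lF cF (initial_hom E \oh b).
by exists.
Qed.

Lemma decomposable_hom_path (X Y : flow) (f : hom X Y) (p : path_space X) :
  decomposable p -> decomposable (hom_path f p).
Proof.
move=> [a [b [c [x [y ->]]]]].
exists (hom0 f a), (hom0 f b), (hom0 f c), (homP f x), (homP f y).
by rewrite /hom_path /= homP_comp.
Qed.

(** The path [p] is new, hence interior to the attached globe, where a bump changes its value
    without affecting the sphere, [C] or [q]. *)
Lemma pushout_bump (A B C D : flow) (f : hom A B) (g : hom A C) (i : hom B D)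
    (j : hom C D) (p q : path_space D) (h : hom D E) :
  generating_cofibration R f -> is_pushout f g i j ->
  ~ decomposable p -> ~ decomposable q -> p <> q ->
  (forall r, hom_path j r <> p) ->
  exists h' : hom D E, value h' p <> value h p /\ value h' q = value h q.
Proof.
move=> Cf po ip iq pq jp.
have [[x xp]|[r /jp//]] := pushout_indecomposable po ip.
have qP := pushout_indecomposable po iq.
(* Only the globe case survives: otherwise [B] has no path [x]. *)
case: Cf g i po x xp qP => [n||] g i po x xp qP; [|by case: x xp..].
have [ij univ] := po.
case: x xp => -[[] []] x // xp.
pose pt (Z : cgspace) (z : Z) := @mkpath (glob Z) false true z.
have xS z : sphere_incl z <> x.
  move=> zx; apply: (jp (hom_path g (pt _ z))); rewrite -xp -zx.
  exact/esym/(congr1 (fun k => hom_path k (pt _ z)) ij).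
(* When [q] comes from [C] its value is kept anyway, and [x] serves as a dummy [y]. *)
have [y yq] : exists y : disk R n,
    (y <> x /\ hom_path i (pt _ y) = q) \/ exists r, hom_path j r = q.
  case: qP => [[[[[] []] y] // yq]|rq]; last by exists x; right.
  by exists y; left; split=> // yx; apply: pq; rewrite -xp -yq yx.
have [w [wf wy wx]] := glob_bump (h \oh i) y xS.
have [|h' [[h'i h'j] _]] := univ _ w (h \oh j).
  by rewrite wf !comp_homA ij.
exists h'; split.
  by rewrite -xp -!value_comp h'i; exact: wx.
case: yq => [[yx <-]|[r <-]]; rewrite -!value_comp ?h'j // h'i.
exact: wy yx.
Qed.

(* At the first stage containing both [p] and [q], one of them is interior to
   the cell being attached, and values at this point can be changed freely. *)
Lemma cell_separation (Y : flow) (p q : path_space Y) :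
  cell R Y -> ~ decomposable p -> ~ decomposable q -> p <> q ->
  exists h : hom Y E, value h p <> value h q.
Proof.
move=> cY; have [h0] := cell_hom cY.
have [d [I [i0 [F [a [c [[wf i0P] sF lF cF [[b _] _]]]]]]]] := cY.
have c_comp k l (h : (k <= l)%O) : c l isT \oh dmap F h = c k isT.
  by case: cF => + _; exact.
pose comes k (r : path_space Y) := exists r', hom_path (c k isT) r' = r.
have comesS k l r : (k <= l)%O -> comes k r -> comes l r.
  move=> kl [r' <-]; exists (hom_path (dmap F kl) r').
  by rewrite -(c_comp k l kl).
have step k i r s : is_successor k i -> ~ comes k r -> comes i r -> comes i s ->
    ~ decomposable r -> ~ decomposable s -> r <> s ->
    exists h : hom Y E, value h r <> value h s.
  move=> ki kr [r' r'E] [s' s'E] ir is_ rs.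
  (* If [h0] does not already separate them, changing the value at [r] alone does. *)
  have [rs0|] := pselect (value h0 r = value h0 s); last by exists h0.
  have [A [B [f [g [j [Cf po]]]]]] := sF k i (ltW ki.1) ki.
  have [||||h1 [h1r h1s]] :=
      @pushout_bump _ _ _ _ _ _ _ _ r' s' (h0 \oh c i isT) Cf po.
  - by move/(decomposable_hom_path (c i isT)); rewrite r'E.
  - by move/(decomposable_hom_path (c i isT)); rewrite s'E.
  - by move=> e; apply: rs; rewrite -r'E -s'E e.
  - move=> y yr; apply: kr; exists y.
    by rewrite -(c_comp k i (ltW ki.1)) -r'E -yr.
  have [h hE] := stage_extension wf i0P sF lF cF h1.
  exists h; move: h1r h1s.
  by rewrite -hE !value_comp r'E s'E -rs0 => + ->.
move=> ip iq pq.
have src r : ~ decomposable r -> exists k, comes k r.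
  move=> ir; have [k [Pk kr]] := colimit_indecomposable cF ir.
  by exists k; rewrite /comes (bool_irrelevance (isT : predT k) Pk).
have [k kp kq] : exists2 k, comes k p & comes k q.
  have [[k kp] [l lq]] := (src p ip, src q iq).
  have [kl|/ltW lk] := leP k l.
    by exists l => //; exact: comesS kl kp.
  by exists k => //; exact: comesS lk lq.
(* Stage [i0] has no path; at a limit stage both paths come from an earlier stage; at a successor
   stage either both were already present or [step] applies. *)
elim/(well_founded_ind wf): k kp kq => k IH kp kq.
have [k0|k0] := pselect (k = i0).
  move: kp; rewrite k0 => -[r _].
  by have := hom_path b r => -[[[]]].
have [[l lk]|nsucc] := pselect (exists l, is_successor l k).
  have [[lp lq]|] := pselect (comes l p /\ comes l q); first exact: IH lk.1 _ _.
  move=> /not_andP [lp|lq]; first by apply: (step l k) => //.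
  have [h hE] := step l k q p lk lq kq kp iq ip (nesym pq).
  by exists h; exact: nesym.
have lim := lF k k0 ((forallNP _).2 nsucc).
have lower r : comes k r -> ~ decomposable r ->
    exists2 l, (l < k)%O & comes l r.
  move=> [r' r'E] ir.
  have [|l [lk [y yr]]] := colimit_indecomposable (p := r') lim.
    by move/(decomposable_hom_path (c k isT)); rewrite r'E.
  by exists l => //; exists y; rewrite -(c_comp l k (ltW lk)) -r'E -yr.
have [l lk lp] := lower p kp ip; have [m mk mq] := lower q kq iq.
have [lm|/ltW ml] := leP l m.
  by apply: (IH m mk) => //; exact: comesS lm lp.
by apply: (IH l lk) => //; exact: comesS ml mq.
Qed.
End CellSeparation.

(** * Laws on the line and heights of paths *)

Section LineOperations.
Variable R : realType.
Local Notation L := (line R).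

Definition length_op (x y : L) : L := (`|x : R| + `|y : R| + 1 : R).

Lemma length_op_norm (x y : L) :
  `|length_op x y : R| = `|x : R| + `|y : R| + 1.
Proof. by rewrite ger0_norm // !addr_ge0. Qed.

Lemma length_op_continuous :
  continuous (fun p : cg_prod L L => length_op p.1 p.2).
Proof.
apply: cg_prod_continuous => K u v hK cu cv k.
apply: (@continuousD R R^o K (fun k => `|u k : R| + `|v k : R|) (cst 1) k).
  apply: (@continuousD R R^o K (fun k => `|u k : R|) (fun k => `|v k : R|) k).
    apply: (continuous_comp (cu k)); exact: norm_continuous.
  apply: (continuous_comp (cv k)); exact: norm_continuous.
exact: cst_continuous.
Qed.

Lemma length_opA : associative length_op.
Proof.
move=> x y z; rewrite {1 3}/length_op !length_op_norm.
by rewrite (addrAC _ 1) !addrA.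
Qed.

Definition fst_op (x y : L) : L := x.
Definition snd_op (x y : L) : L := y.

Lemma fst_op_continuous : continuous (fun p : cg_prod L L => fst_op p.1 p.2).
Proof. exact: cg_fst_continuous. Qed.

Lemma snd_op_continuous : continuous (fun p : cg_prod L L => snd_op p.1 p.2).
Proof. exact: cg_snd_continuous. Qed.

Lemma fst_opA : associative fst_op. Proof. by []. Qed.
Lemma snd_opA : associative snd_op. Proof. by []. Qed.
End LineOperations.

Definition path_height (Y : flow) (m : path_space Y -> nat) : Prop :=
  forall a b c (x : epath Y a b) (y : epath Y b c),
    (m (mkpath x) < m (mkpath (ecomp x y)))%N /\
    (m (mkpath y) < m (mkpath (ecomp x y)))%N.

(** For [length_op], the absolute value at a composite exceeds those at its factors by at least 1,
    so integer parts strictly increase. *)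
Lemma cell_height (R : realType) (Y : flow) :
  cell R Y -> exists m, @path_height Y m.
Proof.
move=> /(cell_hom (@length_op_continuous R) (@length_opA R)) [l].
exists (fun p => Num.truncn `|value l p : R|) => a b c x y.
have -> : value l (mkpath (ecomp x y)) =
    length_op (value l (mkpath x)) (value l (mkpath y)).
  exact: (homP_comp l x y).
have lt (u v : R) : 0 <= u -> u + 1 <= v -> (Num.truncn u < Num.truncn v)%N.
  move=> u0 uv; rewrite truncn_ge_nat; last lra.
  by rewrite (le_trans _ uv) // -natr1 lerD2r truncn_le.
by rewrite length_op_norm; split; apply: lt => //; rewrite lerD2r ?lerDl ?lerDr.
Qed.

(** * Indecomposable first and last factors *)

Section Factors.
Variables (Y : flow) (m : path_space Y -> nat).
Hypothesis mP : path_height m.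

Lemma decomposableE (a c : state Y) (x : epath Y a c) :
  decomposable (mkpath x) ->
  exists (b : state Y) (y : epath Y a b) (z : epath Y b c), x = ecomp y z.
Proof.
move=> [a' [b [c' [y [z e]]]]].
have /= [ea ec] := congr1 (@projT1 _ _) e; subst a' c'.
by exists b, y, z; exact: existT_inj2 e.
Qed.

(** Splitting the left factor as long as it is decomposable terminates, because [m] decreases. *)
Lemma first_factor (a c : state Y) (x : epath Y a c) :
  exists (b : state Y) (u : epath Y a b), ~ decomposable (mkpath u) /\
    (c = b \/ exists y : epath Y b c, x = ecomp u y).
Proof.
(* The induction needs equality of the paths [x] and [u], not only of their ends, to substitute [u]
   for the left factor. *)
suff [b [u [iu [e|xu]]]] : exists (b : state Y) (u : epath Y a b),
    ~ decomposable (mkpath u) /\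
    (mkpath x = mkpath u \/ exists y : epath Y b c, x = ecomp u y).
- exists b, u; split=> //; left.
  by have /= [] := congr1 (@projT1 _ _) e.
- by exists b, u; split=> //; right.
have [k] := ubnP (m (mkpath x)); elim: k => // k IH in a c x *.
have [|ix] := pselect (decomposable (mkpath x)); last first.
  by move=> _; exists c, x; split=> //; left.
move=> /decomposableE [d [y [z e]]]; have [ly _] := mP y z; rewrite -e in ly.
move=> lx; have [|b [u [iu yu]]] := IH a d y; first exact: leq_trans ly _.
exists b, u; split=> //; right; rewrite e.
case: yu => [yu|[w ->]]; last by exists (ecomp w z); exact: ecompA.
have /= [db] := congr1 (@projT1 _ _) yu; subst b.
by exists z; rewrite (existT_inj2 yu).
Qed.

Lemma last_factor (a c : state Y) (x : epath Y a c) :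
  exists (b : state Y) (u : epath Y b c), ~ decomposable (mkpath u) /\
    (a = b \/ exists y : epath Y a b, x = ecomp y u).
Proof.
suff [b [u [iu [e|xu]]]] : exists (b : state Y) (u : epath Y b c),
    ~ decomposable (mkpath u) /\
    (mkpath x = mkpath u \/ exists y : epath Y a b, x = ecomp y u).
- exists b, u; split=> //; left.
  by have /= [] := congr1 (@projT1 _ _) e.
- by exists b, u; split=> //; right.
have [k] := ubnP (m (mkpath x)); elim: k => // k IH in a c x *.
have [|ix] := pselect (decomposable (mkpath x)); last first.
  by move=> _; exists a, x; split=> //; left.
move=> /decomposableE [d [y [z e]]]; have [_ lz] := mP y z; rewrite -e in lz.
move=> lx; have [|b [u [iu zu]]] := IH d c z; first exact: leq_trans lz _.
exists b, u; split=> //; right; rewrite e.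
case: zu => [zu|[w ->]]; last by exists (ecomp y w); exact/esym/ecompA.
have /= [db] := congr1 (@projT1 _ _) zu; subst b.
by exists y; rewrite (existT_inj2 zu).
Qed.
End Factors.

(** * Consequences of singleton branching and merging spaces *)

Lemma quotient_singleton (T Z W : cgspace) (S : T -> T -> Prop) (q : T -> Z)
    (h : T -> W) :
  is_cg_quotient (equivalence_closure S) q -> is_singleton Z ->
  continuous h -> (forall x y, S x y -> h x = h y) -> forall x y, h x = h y.
Proof.
move=> [_ _ univ] [z zP] ch hS x y.
have [|k [[_ kq] _]] := univ W h ch.
  by move=> u v; elim=> {u v} [u v /hS|u|u v _ ->|u v w _ -> _ ->].
by rewrite -!kq (zP (q x)) (zP (q y)).
Qed.

(** Under the law [fst_op], a morphism takes the same value on a path and on its first factor, so it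
    is constant on all paths from [a]. As such morphisms separate indecomposable paths, all these
    paths have the same indecomposable first factor. The height inequality serves a later
    induction. *)
Lemma unique_successor (R : realType) (Y : flow) (m : path_space Y -> nat)
    (a c0 : state Y) (x0 : epath Y a c0) (Z : cgspace) :
  cell R Y -> path_height m -> is_branching_space a Z -> is_singleton Z ->
  exists2 b, inhabited (epath Y a b) & forall c (x : epath Y a c),
    c = b \/ exists y : epath Y b c, (m (mkpath y) < m (mkpath x))%N.
Proof.
move=> cY mP [q hq] sZ.
have [b [u [iu _]]] := first_factor mP x0.
exists b; first by exists.
move=> c x; have [b' [u' [iu' xE]]] := first_factor mP x.
suff eb : b' = b.
  subst b'; case: xE => [|[y ->]]; [by left|right; exists y].
  exact: (mP a b c u' y).2.
have [|uu] := pselect (mkpath u' = mkpath u).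
  by move/(congr1 (@projT1 _ _)) => -[].
have [h []] :=
  cell_separation (@fst_op_continuous R) (@fst_opA R) cY iu' iu uu.
pose H (p : paths_from a) : line R := homP h (projT2 p).
have cH : continuous H.
  apply: (@sigT_continuous _ (fun b => epath Y a b : topologicalType) (line R)
    (fun b x => homP h x)) => d.
  exact: (@homP_continuous _ _ h a d).
apply: (quotient_singleton hq sZ cH _ (existT _ b' u') (existT _ b u)).
move=> _ _ [d [e [v [w [-> ->]]]]].
exact/esym/(homP_comp h v w).
Qed.

(** Dual argument, with last factors and the law [snd_op]. *)
Lemma unique_predecessor (R : realType) (Y : flow) (m : path_space Y -> nat)
    (a c0 : state Y) (x0 : epath Y c0 a) (Z : cgspace) :
  cell R Y -> path_height m -> is_merging_space a Z -> is_singleton Z ->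
  exists2 b, inhabited (epath Y b a) & forall c (x : epath Y c a),
    c = b \/ exists y : epath Y c b, (m (mkpath y) < m (mkpath x))%N.
Proof.
move=> cY mP [q hq] sZ.
have [b [u [iu _]]] := last_factor mP x0.
exists b; first by exists.
move=> c x; have [b' [u' [iu' xE]]] := last_factor mP x.
suff eb : b' = b.
  subst b'; case: xE => [|[y ->]]; [by left|right; exists y].
  exact: (mP c b a y u').1.
have [|uu] := pselect (mkpath u' = mkpath u).
  by move/(congr1 (@projT1 _ _)) => -[].
have [h []] :=
  cell_separation (@snd_op_continuous R) (@snd_opA R) cY iu' iu uu.
pose H (p : paths_to a) : line R := homP h (projT2 p).
have cH : continuous H.
  apply: (@sigT_continuous _ (fun b => epath Y b a : topologicalType) (line R)
    (fun b x => homP h x)) => d.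
  exact: (@homP_continuous _ _ h d a).
apply: (quotient_singleton hq sZ cH _ (existT _ b' u') (existT _ b u)).
move=> _ _ [d [e [v [w [-> ->]]]]].
exact/esym/(homP_comp h v w).
Qed.

(** * Reachability between states *)

Definition reach (X : flow) (a b : state X) : Prop := inhabited (epath X a b).

Lemma reach_trans (X : flow) (a b c : state X) :
  reach a b -> reach b c -> reach a c.
Proof. by move=> [x] [y]; exact: (inhabits (ecomp x y)). Qed.

Lemma reach_hom (X Y : flow) (f : hom X Y) (a b : state X) :
  reach a b -> reach (hom0 f a) (hom0 f b).
Proof. by move=> [x]; exact: (inhabits (homP f x)). Qed.

Lemma S_homotopic_hom0 (R : realType) (X Y : flow) (f g : hom X Y) :
  S_homotopic R f g -> forall a, hom0 f a = hom0 g a.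
Proof.
move=> [H [_ H1 Hc _]] a.
have h1 : `[0, 1]%classic (1 : R) by rewrite /= in_itv /= lexx ler01.
by rewrite -(Hc (in_set h1 : interval R)) H1.
Qed.

Lemma exists_third (i j : 'I_3) : i != j -> exists2 k : 'I_3, i != k & j != k.
Proof.
case: i j => [[|[|[|]]] hi] // [[|[|[|]]] hj] // _;
  first [by exists (inord 0); rewrite -val_eqE /= inordK
        |by exists (inord 1); rewrite -val_eqE /= inordK
        |by exists (inord 2); rewrite -val_eqE /= inordK].
Qed.

(** * Crowns of a transitive relation and their retraction *)

Section Crown.
Variables (T : Type) (r : T -> T -> Prop).
Hypothesis r_trans : forall x y z, r x y -> r y z -> r x z.

Definition crown (a b : 'I_3 -> T) : Prop :=
  forall i j, r (a i) (b j) <-> i != j.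

Definition replace (a : 'I_3 -> T) (i : 'I_3) (c : T) : 'I_3 -> T :=
  fun j => if j == i then c else a j.

(** Whatever [a i] reaches is [c] or is reached from [c], so the point is to exclude [b j = c]. *)
Lemma crown_replace (a b : 'I_3 -> T) (i : 'I_3) (c : T) :
  crown a b -> r (a i) c -> (forall d, r (a i) d -> d = c \/ r c d) ->
  crown (replace a i c) b.
Proof.
move=> ab ic iP k j; rewrite /replace; case: eqP => [->|_]; last exact: ab.
split=> [cj|ij]; first by apply/ab; exact: r_trans cj.
have [bc|//] := iP (b j) ((ab i j).2 ij).
(* A third index makes [b j = c] absurd: either [b k' = b j], which [a j] would then reach, or [b j]
   reaches [b k'], and then so does [a k']. *)
have [k' ik' jk'] := exists_third ij.
have [bk|] := iP (b k') ((ab i k').2 ik').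
  by have := (ab j k').2 jk'; rewrite bk -bc => /ab; rewrite eqxx.
rewrite -bc => rjk; have kj : k' != j by rewrite eq_sym.
by have /ab := r_trans ((ab k' j).2 kj) rjk; rewrite eqxx.
Qed.

Variable A : set T.

(** A finite chain from [x] into [A], each step going to a point through which everything beyond
    passes. *)
Inductive retractable : T -> Prop :=
| Retracted x : A x -> retractable x
| RetractStep x c : r x c -> (forall d, r x d -> d = c \/ r c d) ->
    retractable c -> retractable x.

Lemma crown_retract1 (a b : 'I_3 -> T) (i : 'I_3) :
  retractable (a i) -> crown a b -> exists2 c, A c & crown (replace a i c) b.
Proof.
move=> rx; move e : (a i) rx => x rx.
elim: rx a e => {x} [x Ax|x c xc xP _ IH] a e ab.
  exists x => //; rewrite -e.
  suff -> : replace a i (a i) = a by [].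
  by apply/funext => j; rewrite /replace; case: eqP => [->|].
subst x; have [||d Ad dP] := IH (replace a i c).
- by rewrite /replace eqxx.
- exact: crown_replace.
exists d => //; suff <- : replace (replace a i c) i d = replace a i d by [].
by apply/funext => j; rewrite /replace; case: eqP.
Qed.

Lemma crown_retract (a b : 'I_3 -> T) :
  (forall x, retractable x) -> crown a b ->
  exists2 a', forall i, A (a' i) & crown a' b.
Proof.
move=> rA ab.
(* The three points are moved one after the other; those already moved stay in [A]. *)
suff [a' a'A a'b] : exists2 a', {in enum 'I_3, forall i, A (a' i)} & crown a' b.
  by exists a' => // i; apply: a'A; rewrite mem_enum.
elim: (enum 'I_3) => [|i s [a' a's a'b]]; first by exists a.
have [c Ac cb] := crown_retract1 (rA (a' i)) a'b.
exists (replace a' i c) => // j; rewrite inE /replace.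
by case: eqP => //= _; exact: a's.
Qed.
End Crown.

Lemma crown_flip (T : Type) (r : T -> T -> Prop) (a b : 'I_3 -> T) :
  crown r a b -> crown (fun x y => r y x) b a.
Proof. by move=> ab i j; rewrite eq_sym; exact: ab. Qed.

(** * Invariance of crowns under S- and T-homotopy equivalences *)

Definition has_crown (X : flow) : Prop := exists a b, crown (@reach X) a b.

Lemma has_crown_reach (X Y : flow) (f : state X -> state Y) :
  (forall a b, reach (f a) (f b) <-> reach a b) -> has_crown X -> has_crown Y.
Proof.
move=> fr [a [b ab]]; exists (f \o a), (f \o b) => i j.
by rewrite /= fr; exact: ab.
Qed.

(** S-homotopies are constant on states, so [f] and [g] are mutually inverse there, and both
    preserve reachability. *)
Lemma S_homotopy_equivalence_crown (R : realType) (X Y : flow) (f : hom X Y) :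
  S_homotopy_equivalence R f -> has_crown X <-> has_crown Y.
Proof.
move=> [g [/S_homotopic_hom0 gf /S_homotopic_hom0 fg]]; split.
  apply: (has_crown_reach (f := hom0 f)) => a b; split; last exact: reach_hom.
  by move/(reach_hom g); rewrite [hom0 g _]gf [hom0 g _]gf.
apply: (has_crown_reach (f := hom0 g)) => a b; split; last exact: reach_hom.
by move/(reach_hom f); rewrite [hom0 f _]fg [hom0 f _]fg.
Qed.

Lemma corestriction_reach (X Y : flow) (f : hom X Y) :
  is_iso (corestriction f) ->
  forall a b, reach (hom0 f a) (hom0 f b) <-> reach a b.
Proof.
move=> [g [gf fg]] a b; split; last exact: reach_hom.
move=> r.
have : reach (hom0 (corestriction f) a) (hom0 (corestriction f) b) by [].
move/(reach_hom g).
have e c : hom0 g (hom0 (corestriction f) c) = c.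
  exact: (congr1 (fun h => hom0 h c) gf).
by rewrite !e.
Qed.

Section Retract.
Variables (R : realType) (X Y : flow) (f : hom X Y).
Hypothesis cY : cell R Y.
Hypothesis Tf : T_homotopy_equivalence f.

(** Induction on the height of a path [x0] from [y] to the image: if the successor [c] of [y] is
    outside the image, a path of smaller height leads from [c] to the end of [x0]. *)
Lemma T_retractable_lower (y : state Y) :
  retractable (@reach Y) (range (hom0 f)) y.
Proof.
have [_ sing paths] := Tf; have [m mP] := cell_height cY.
have [Ay|nAy] := pselect (range (hom0 f) y); first exact: Retracted.
have [_ [c0 [x0]]] := paths _ nAy.
have [k] := ubnP (m (mkpath x0)); elim: k => // k IH in y nAy x0 *.
rewrite ltnS => x0k.
have [[Z qZ sZ] _] := sing _ nAy.
have [c yc cP] := unique_successor x0 cY mP qZ sZ.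
apply: RetractStep yc _ _.
  by move=> d [x]; case: (cP d x) => [|[z _]]; [left|right; exists].
have [Ac|nAc] := pselect (range (hom0 f) c); first exact: Retracted.
have [e|[x1 lt]] := cP _ x0; first by case: nAc; rewrite -e; exact: imageT.
exact: (IH c nAc x1 (leq_trans lt x0k)).
Qed.

Lemma T_retractable_upper (y : state Y) :
  retractable (fun a b => @reach Y b a) (range (hom0 f)) y.
Proof.
have [_ sing paths] := Tf; have [m mP] := cell_height cY.
have [Ay|nAy] := pselect (range (hom0 f) y); first exact: Retracted.
have [[c0 [x0]] _] := paths _ nAy.
have [k] := ubnP (m (mkpath x0)); elim: k => // k IH in y nAy x0 *.
rewrite ltnS => x0k.
have [_ [Z qZ sZ]] := sing _ nAy.
have [c yc cP] := unique_predecessor x0 cY mP qZ sZ.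
apply: RetractStep yc _ _.
  by move=> d [x]; case: (cP d x) => [|[z _]]; [left|right; exists].
have [Ac|nAc] := pselect (range (hom0 f) c); first exact: Retracted.
have [e|[x1 lt]] := cP _ x0; first by case: nAc; rewrite -e; exact: imageT.
exact: (IH c nAc x1 (leq_trans lt x0k)).
Qed.

(** From [Y] to [X], the [a i] are moved into the image first; the [b j] are then moved for the
    reversed relation, which leaves the [a' i] fixed. *)
Lemma T_homotopy_equivalence_crown : has_crown X <-> has_crown Y.
Proof.
have fr := corestriction_reach (let: And3 iso _ _ := Tf in iso).
split; first exact: has_crown_reach fr.
move=> [a [b ab]].
have [a' a'A a'b] :=
  crown_retract (@reach_trans Y) T_retractable_lower ab.
have [|b' b'A b'a'] :=
    crown_retract _ T_retractable_upper (crown_flip a'b).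
  by move=> u v w vu wv; exact: reach_trans wv vu.
have a'b' := crown_flip b'a'.
pose u i := projT1 (cid2 (a'A i)); pose v i := projT1 (cid2 (b'A i)).
have uE i : hom0 f (u i) = a' i by rewrite /u; case: cid2.
have vE i : hom0 f (v i) = b' i by rewrite /v; case: cid2.
by exists u, v => i j; rewrite -fr uE vE; exact: a'b'.
Qed.
End Retract.

(** * Crowns of the cube and of the segment *)

Lemma joined_index (R : realType) (I : choiceType) (X : I -> cgspace)
    (p q : cg_sum X) :
  joined R p q -> projT1 p = projT1 q.
Proof.
move=> [c [cc c0 c1]].
have h0 : `[0, 1]%classic (0 : R) by rewrite /= in_itv /= lexx ler01.
have h1 : `[0, 1]%classic (1 : R) by rewrite /= in_itv /= lexx ler01.
have [oF cF] := fiber_clopen (X := X) (projT1 p) cc.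
suff : fiber c (projT1 p) (in_set h1 : interval R).
  by rewrite /fiber /= c1.
pose D := (set_val : set_type `[0, 1]%classic -> R) @` fiber c (projT1 p).
have DE : D = `[0, 1]%classic.
  apply: (@segment_connected R 0 1).
  - exists 0, (in_set h0) => //; by rewrite /fiber /= c0.
  - have [W oW WF] := oF; exists W => //.
    rewrite predeqE => t; split=> [[u Fu <-]|[t01 Wt]].
      by split; [exact: set_valP|move: Fu; rewrite -WF].
    by exists (in_set t01) => //; rewrite -WF.
  - have [W oW WF] := closed_openC cF; exists (~` W); first exact: open_closedC.
    rewrite predeqE => t; split=> [[u Fu <-]|[t01 Wt]].
      split; first exact: set_valP.
      by move=> Wu; suff : (~` fiber c (projT1 p)) u by []; rewrite -WF.
    exists (in_set t01) => //; apply: contrapT => nF; apply: Wt.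
    by suff : (set_val @^-1` W) (in_set t01) by []; rewrite WF.
have : D 1 by rewrite DE.
by move=> [u Fu u1]; suff <- : u = in_set h1 by []; exact: val_inj.
Qed.

(** Surjectivity on path components gives a path of [X] whose image is joined to the given path,
    hence has the same endpoints; [f] is injective on states. *)
Lemma weak_S_reach (R : realType) (X Y : flow) (f : hom X Y) :
  weak_S_homotopy_equivalence R f ->
  forall a b, reach (hom0 f a) (hom0 f b) <-> reach a b.
Proof.
move=> [/bij_inj finj [_ _ surj _ _]] a b; split; last exact: reach_hom.
move=> [x]; have [[[a' b'] x'] /joined_index [/finj <- /finj <-]] :=
  surj (mkpath x).
by exists.
Qed.

Lemma reach_segment (a b : bool) :
  reach (X := directed_segment) a b <-> ~~ a && b.
Proof.
split; first by case: a b => -[] [[]].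
by case: a b => -[] // _; exact: (inhabits tt).
Qed.

Lemma reach_tensor (X Y : flow) (rX : rel (state X)) (rY : rel (state Y)) :
  (forall a b, reach a b <-> rX a b) -> (forall a b, reach a b <-> rY a b) ->
  forall p q : state (tensor X Y), reach p q <->
    [|| rX p.1 q.1 && rY p.2 q.2, (p.1 == q.1) && rY p.2 q.2 |
        rX p.1 q.1 && (p.2 == q.2)].
Proof.
move=> hX hY p q; split.
  move=> [[[[[] []] //= k] [x y]]].
  - by rewrite (hX _ _).1 ?(hY _ _).1; [|exists|exists].
  - have e : p.2 = q.2 := y.
    by rewrite (hX _ _).1 ?e ?eqxx ?orbT; [|exists].
  - have e : p.1 = q.1 := x.
    by rewrite (hY _ _).1 ?e ?eqxx ?orbT; [|exists].
case/or3P=> /andP[].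
- move=> /hX [x] /hY [y]; exists.
  by exists (exist (fun k : bool * bool => k.1 || k.2) (true, true) isT).
- move=> /eqP e /hY [y]; exists.
  by exists (exist (fun k : bool * bool => k.1 || k.2) (false, true) isT).
- move=> /hX [x] /eqP e; exists.
  by exists (exist (fun k : bool * bool => k.1 || k.2) (true, false) isT).
Qed.

(** The 3-cube is embedded in higher cubes as the face where the additional coordinates are
    [false]. *)
Lemma cube_has_crown (n : nat) : has_crown (tensor_pow directed_segment n.+3).
Proof.
elim: n => [|n].
  pose lt (a b : bool) := ~~ a && b.
  have h2 := @reach_tensor directed_segment directed_segment lt lt
    reach_segment reach_segment.
  have h3 := @reach_tensor directed_segment _ lt _ reach_segment h2.
  (* The atoms, with only coordinate [i] true, and then the coatoms, with only coordinate [i]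
     false. *)
  exists (fun i : 'I_3 => (val i == 0, (val i == 1, val i == 2))%N).
  exists (fun i : 'I_3 => (val i != 0, (val i != 1, val i != 2))%N).
  move=> i j; split=> [/h3|ij]; last apply/h3.
    by case: i j => [[|[|[|]]] hi] // [[|[|[|]]] hj].
  by case: i j ij => [[|[|[|]]] hi] // [[|[|[|]]] hj].
apply: (has_crown_reach (Y := tensor directed_segment _)
  (f := fun a => (false, a))) => a b.
have hr := @reach_tensor directed_segment (tensor_pow directed_segment n.+3)
  (fun a b : bool => ~~ a && b) (fun a b => `[< reach a b >]) reach_segment
  (fun a b => rwP (asboolP (reach a b))).
by rewrite hr /= orbF; exact: iff_sym (rwP (asboolP _)).
Qed.

(** Every [a i] would be the initial state and every [b j] the final one. *)
Lemma segment_no_crown : ~ has_crown directed_segment.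
Proof.
move=> [a [b ab]].
have lt (i j : 'I_3) : i != j -> a i = false /\ b j = true.
  by move=> /ab /reach_segment /andP[/negbTE].
have [a0 _] := lt (inord 0) (inord 1) ltac:(by rewrite -val_eqE /= !inordK).
have [_ b0] := lt (inord 1) (inord 0) ltac:(by rewrite -val_eqE /= !inordK).
have : reach (a (inord 0)) (b (inord 0)) by rewrite a0 b0; exact/reach_segment.
by move/ab; rewrite eqxx.
Qed.

(* Transport of crowns along the zig-zag *)
Local Close Scope ring_scope.
Local Close Scope classical_set_scope.

Theorem theorem3p4 (R : realType) (Q : cofibrant_replacement R) (n : nat)
    (hn : 3 <= n) :
  ~ exists (m : nat) (X : nat -> flow)
      (f : forall i, i < m -> hom (X i.*2) (X i.*2.+1))
      (g : forall i, i < m -> hom (X i.*2.+2) (X i.*2.+1)),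
    [/\ 1 <= m,
      X 0 = full_cube Q n /\ X m.*2 = directed_segment,
      forall i, i <= m.*2 -> cell R (X i),
      forall i (hi : i < m),
        S_homotopy_equivalence R (f i hi) \/ T_homotopy_equivalence (f i hi) &
      forall i (hi : i < m),
        S_homotopy_equivalence R (g i hi) \/ T_homotopy_equivalence (g i hi)].
Proof.
move=> [m [X [f [g [_ [X0 Xm] cX fP gP]]]]].
have crown_iff (A B : flow) (h : hom A B) : cell R B ->
    S_homotopy_equivalence R h \/ T_homotopy_equivalence h ->
    has_crown A <-> has_crown B.
  move=> cB [/S_homotopy_equivalence_crown//|Th].
  exact: T_homotopy_equivalence_crown cB Th.
have X_crown i : (i <= m) -> has_crown (X i.*2).
  elim: i => [_|i IH im].
    rewrite X0 /full_cube -(subnK hn) addn3.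
    have wQ :=
      Qproj_weak_equivalence Q (tensor_pow directed_segment (n - 3).+3).
    (* [h] inverts the projection on states and carries the crown of the tensor power to its
       replacement. *)
    have [[h _ hK] _] := wQ.
    apply: (has_crown_reach (f := h) _ (cube_has_crown (n - 3))) => a b.
    by rewrite -(weak_S_reach wQ) !hK.
  (* Both arrows end at this object, so its cell structure serves for both. *)
  have cX1 : cell R (X i.*2.+1).
    by apply: cX; rewrite ltn_double.
  rewrite doubleS.
  apply/(crown_iff _ _ _ cX1 (gP i im)); apply/(crown_iff _ _ _ cX1 (fP i im)).
  exact: IH (ltnW im).
by apply: segment_no_crown; rewrite -Xm; exact: X_crown.
Qed.
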